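(* Let $\mathfrak g$ be a transitive Lie algebra of holomorphic vector fields on a complex manifold $M$ with $\mathrm H^1_{dR}(M)=0$. If, for every $p\in M$, the isotropy algebra $\mathfrak g_p$ does not have an ideal of codimension $1$, then the map $\mathrm{Pic}_{\mathfrak g}(M)\to\mathrm{Pic}(M)$ is injective.
   Context: $\mathfrak g$ is transitive if $\{X_p:X\in\mathfrak g\}=T_pM$ for every $p\in M$; $\mathfrak g_p=\{X\in\mathfrak g: X_p=0\}$ is the isotropy algebra of $p$. $\mathrm H^k_{dR}(M)$ is the holomorphic de Rham cohomology, i.e. the hypercohomology $\mathbb H^k(M,\Omega^\bullet_M)$ of the complex of sheaves of holomorphic forms on $M$. A lift of $\mathfrak g$ to a holomorphic line bundle $\pi\colon L\to M$ is a Lie algebra $\hat{\mathfrak g}$ of projectable holomorphic vector fields on $L$, commuting with the vertical field $u\partial_u$ ($u$ a linear fiber coordinate), such that $d\pi\colon\hat{\mathfrak g}\to\mathfrak g$ is a Lie algebra isomorphism; $(L,\hat{\mathfrak g})$ is a $\mathfrak g$-equivariant line bundle. $\mathrm{Pic}_{\mathfrak g}(M)$ is the group (under tensor product) of equivalence classes of $\mathfrak g$-equivariant line bundles over $M$; $\mathrm{Pic}(M)$ is the group of holomorphic line bundles up to equivalence. The map $\mathrm{Pic}_{\mathfrak g}(M)\to\mathrm{Pic}(M)$ forgets the lift. *)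

(* Defs.v *)
From HB Require Import structures.
From mathcomp Require Import all_boot all_order all_algebra.
From mathcomp Require Import complex.
From mathcomp Require Import all_classical all_reals all_analysis.

Set Implicit Arguments.
Unset Strict Implicit.
Unset Printing Implicit Defensive.

Import Order.TTheory GRing.Theory Num.Theory.
Import numFieldNormedType.Exports.

Local Open Scope classical_set_scope.
Local Open Scope ring_scope.

(* The complex numbers, seen as a numClosedFieldType so that the norm topology
   of a numerical field applies to them.  [differentiable] for maps between
   normed modules over [Cplx R] is then complex (Frechet) differentiability,
   and a map is holomorphic on an open set when it is differentiable at each
   of its points. *)
Definition Cplx (R : realType) : numClosedFieldType := R[i]%C.

(* The chart [i] is the map [crd i] restricted to [dom i]; [crd_inv i] is its
   inverse, relevant only on the image of [dom i]. *)
Record atlas (R : realType) (T : topologicalType) (n : nat) := Atlas {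
  idx : Type;
  dom : idx -> set T;
  crd : idx -> T -> 'rV[Cplx R]_n;
  crd_inv : idx -> 'rV[Cplx R]_n -> T }.
Arguments dom {R T n} A : rename.
Arguments crd {R T n} A : rename.
Arguments crd_inv {R T n} A : rename.

Record complex_manifold (R : realType) (T : topologicalType) (n : nat)
    (A : atlas R T n) : Prop := ComplexManifold {
  cm_hausdorff : hausdorff_space T;
  cm_countable : @second_countable T;
  cm_cover : forall p : T, exists i, dom A i p;
  cm_open_dom : forall i, open (dom A i);
  cm_open_im : forall i, open (crd A i @` dom A i);
  cm_inv : forall i p, dom A i p -> crd_inv A i (crd A i p) = p;
  cm_crd_cont : forall i p, dom A i p -> {for p, continuous (crd A i)};
  cm_inv_cont : forall i p, dom A i p ->
    {for crd A i p, continuous (crd_inv A i)};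
  cm_compat : forall i j p, dom A i p -> dom A j p ->
    differentiable (crd A j \o crd_inv A i) (crd A i p) }.

Definition holomorphic_map (R : realType) (S T : topologicalType) (m n : nat)
    (A : atlas R S m) (B : atlas R T n) (f : S -> T) : Prop :=
  continuous f /\
  forall p i k, dom A i p -> dom B k (f p) ->
    differentiable (crd B k \o f \o crd_inv A i) (crd A i p).

Lemma near_eq_diff (K : numFieldType) (V W : normedModType K) (f g : V -> W)
  (x : V) : (\forall z \near x, f z = g z) -> differentiable f x ->
  differentiable g x.
Proof.
move=> fg df.
have fgx : f x = g x by exact: (nbhs_singleton fg).
have key : g \o shift x = cst (g x) + 'd f x +o_ 0 id.
  apply/eqaddoP => _/posnumP[e].
  have /eqaddoP /(_ e%:num) /(_ [gt0 of e%:num]) := diff_locally df.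
  have : \forall h \near 0, f (h + x) = g (h + x).
    by have := @near_shift _ _ 0 x (fun z => f z = g z) => /=; rewrite subr0 => <-.
  apply: filterS2 => h /= E; congr (`|_| <= _).
  by rewrite !fctE /= E fgx.
apply/diff_locallyP; rewrite (diff_unique (diff_continuous df) key).
by split => //; exact: diff_continuous.
Qed.

Lemma holomorphic_comp (R : realType) (S T U : topologicalType)
  (l m n : nat) (A : atlas R S l) (B : atlas R T m) (D : atlas R U n)
  (f : S -> T) (g : T -> U) :
  complex_manifold A -> complex_manifold B ->
  holomorphic_map A B f -> holomorphic_map B D g ->
  holomorphic_map A D (g \o f).
Proof.
move=> hA hB [fc fd] [gc gd]; split; first by move=> x; apply: continuous_comp; [exact: fc | exact: gc].
move=> p i k pi gk; have [j fj] := cm_cover hB (f p).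
apply: (near_eq_diff (f := (crd D k \o g \o crd_inv B j) \o (crd B j \o f \o crd_inv A i))).
  have hc : (f \o crd_inv A i) @ crd A i p --> (f \o crd_inv A i) (crd A i p).
    by apply: (@continuous_comp _ _ _ (crd_inv A i) f); [exact: (cm_inv_cont hA pi) | exact: fc].
  have : nbhs ((f \o crd_inv A i) (crd A i p)) (dom B j).
    by apply: open_nbhs_nbhs; split; [exact: (cm_open_dom hB) | rewrite /= (cm_inv hA)].
  move=> /hc H.
  have {}H : \forall z \near crd A i p, dom B j (f (crd_inv A i z)).
    exact: H.
  by near=> z => /=; rewrite (cm_inv hB) //; near: z; exact: H.
apply: differentiable_comp; first exact: fd.
by rewrite /= (cm_inv hA) //; exact: gd.
Unshelve. all: by end_near. Qed.

(* A tangent vector at [p] is the family of its coordinate vectors in the charts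
   around [p], related by the Jacobians of the changes of charts; the value 0 in
   the other charts makes equality of tangent vectors Leibniz equality. *)
Definition tangent (R : realType) (T : topologicalType) (n : nat)
    (A : atlas R T n) (p : T) : set (idx A -> 'rV[Cplx R]_n) :=
  [set v | (forall i, ~ dom A i p -> v i = 0) /\
    forall i j, dom A i p -> dom A j p ->
      v j = 'd (crd A j \o crd_inv A i) (crd A i p) (v i)].
Arguments tangent {R T n} A p _.

Definition field_family (R : realType) (T : topologicalType) (n : nat)
    (A : atlas R T n) : Type := T -> idx A -> 'rV[Cplx R]_n.

Definition vf_comp (R : realType) (T : topologicalType) (n : nat)
    (A : atlas R T n) (X : field_family A) (i : idx A) :
    'rV[Cplx R]_n -> 'rV[Cplx R]_n :=
  fun z => X (crd_inv A i z) i.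

(* Holomorphic vector fields. *)
Definition vector_field (R : realType) (T : topologicalType) (n : nat)
    (A : atlas R T n) : set (field_family A) :=
  [set X | (forall p, tangent A p (X p)) /\
    forall i p, dom A i p -> differentiable (vf_comp X i) (crd A i p)].
Arguments vector_field {R T n} A _.

Definition vf_zero (R : realType) (T : topologicalType) (n : nat)
    (A : atlas R T n) : field_family A := fun _ _ => 0.
Arguments vf_zero {R T n} A _ _.

Definition vf_lin (R : realType) (T : topologicalType) (n : nat)
    (A : atlas R T n) (a : Cplx R) (X Y : field_family A) : field_family A :=
  fun p i => a *: X p i + Y p i.

(* [X, Y]^k = \sum_l (X^l dY^k/dz^l - Y^l dX^k/dz^l) in each chart. *)
Definition bracket (R : realType) (T : topologicalType) (n : nat)
    (A : atlas R T n) (X Y : field_family A) : field_family A :=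
  fun p i => if `[< dom A i p >] then
      'd (vf_comp Y i) (crd A i p) (X p i) - 'd (vf_comp X i) (crd A i p) (Y p i)
    else 0.

Definition subspace (R : realType) (T : topologicalType) (n : nat)
    (A : atlas R T n) (g : set (field_family A)) : Prop :=
  g (vf_zero A) /\
  forall a X Y, g X -> g Y -> g (vf_lin a X Y).

(* Not necessarily finite-dimensional. *)
Definition lie_algebra_of_vf (R : realType) (T : topologicalType) (n : nat)
    (A : atlas R T n) (g : set (field_family A)) : Prop :=
  [/\ g `<=` vector_field A, subspace g &
      forall X Y, g X -> g Y -> g (bracket X Y)].

Definition transitive_vf (R : realType) (T : topologicalType) (n : nat)
    (A : atlas R T n) (g : set (field_family A)) : Prop :=
  forall p, [set X p | X in g] = tangent A p.

Definition isotropy (R : realType) (T : topologicalType) (n : nat)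
    (A : atlas R T n) (g : set (field_family A)) (p : T) :
    set (field_family A) :=
  [set X | g X /\ X p = fun=> 0].

Definition ideal (R : realType) (T : topologicalType) (n : nat)
    (A : atlas R T n) (k h : set (field_family A)) : Prop :=
  [/\ h `<=` k, subspace h & forall X Y, k X -> h Y -> h (bracket X Y)].

(* The quotient [k / h] is spanned by the nonzero class of some [X0]. *)
Definition codim1 (R : realType) (T : topologicalType) (n : nat)
    (A : atlas R T n) (k h : set (field_family A)) : Prop :=
  exists2 X0, k X0 /\ ~ h X0 &
    forall X, k X -> exists a, exists2 Y, h Y & X = vf_lin a X0 Y.

(* [Y] at [f p] is the image of [X] at [p] under the differential of [f]. *)
Definition related (R : realType) (S T : topologicalType) (m n : nat)
    (A : atlas R S m) (B : atlas R T n) (f : S -> T)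
    (X : field_family A) (Y : field_family B) : Prop :=
  forall p i k, dom A i p -> dom B k (f p) ->
    Y (f p) k = 'd (crd B k \o f \o crd_inv A i) (crd A i p) (X p i).

Definition projectable (R : realType) (S T : topologicalType) (m n : nat)
    (A : atlas R S m) (B : atlas R T n) (f : S -> T)
    (X : field_family A) : Prop :=
  exists2 Y, vector_field B Y & related f X Y.
Arguments projectable {R S T m n A} B f X.

(* The vector field [df X]; it is unique when [f] is onto and [X] is
   projectable, and the value is irrelevant otherwise. *)
Definition pushforward (R : realType) (S T : topologicalType) (m n : nat)
    (A : atlas R S m) (B : atlas R T n) (f : S -> T)
    (X : field_family A) : field_family B :=
  match pselect (projectable B f X) with
  | left pX => s2val (cid2 pX)
  | right _ => vf_zero B
  end.
Arguments pushforward {R S T m n A} B f X _ _.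

Definition lie_isomorphism (R : realType) (S T : topologicalType) (m n : nat)
    (A : atlas R S m) (B : atlas R T n)
    (g : set (field_family A)) (h : set (field_family B))
    (phi : field_family A -> field_family B) : Prop :=
  [/\ set_bij g h phi,
      (forall a X Y, g X -> g Y ->
         phi (vf_lin a X Y) = vf_lin a (phi X) (phi Y)) &
      forall X Y, g X -> g Y ->
         phi (bracket X Y) = bracket (phi X) (phi Y)].

(* Over [triv j] the bundle is trivialized by [e |-> (bproj e, fib j e)], with
   inverse [(p, u) |-> tinv j p u]. *)
Record bundle_data (R : realType) (T : topologicalType) := BundleData {
  tot : topologicalType;
  bproj : tot -> T;
  tidx : Type;
  triv : tidx -> set T;
  fib : tidx -> tot -> Cplx R;
  tinv : tidx -> T -> Cplx R -> tot }.

(* The charts of the total space are indexed by pairs of a chart of the base and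
   a trivialization; the fiber coordinate is the last one. *)
Definition total_atlas (R : realType) (T : topologicalType) (n : nat)
    (A : atlas R T n) (L : bundle_data R T) : atlas R (tot L) (n + 1) :=
  {| idx := (idx A * tidx L)%type;
     dom := fun ij => [set e | dom A ij.1 (bproj e) /\ triv ij.2 (bproj e)];
     crd := fun ij e => row_mx (crd A ij.1 (bproj e)) (const_mx (fib ij.2 e));
     crd_inv := fun ij z => tinv ij.2 (crd_inv A ij.1 (lsubmx z)) (rsubmx z 0 0) |}.
Arguments total_atlas {R T n} A L.

(* By [lb_total] the trivializations are biholomorphic, and the transition
   functions, hence the linear structure on the fibers given by [lb_linear],
   depend holomorphically on the base point. *)
Record is_line_bundle (R : realType) (T : topologicalType) (n : nat)
    (A : atlas R T n) (L : bundle_data R T) : Prop := IsLineBundle {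
  lb_cover : forall p : T, exists j : tidx L, triv j p;
  lb_open : forall j : tidx L, open (triv j);
  lb_proj : forall (j : tidx L) p u, triv j p -> bproj (tinv j p u) = p;
  lb_fib : forall (j : tidx L) p u, triv j p -> fib j (tinv j p u) = u;
  lb_tinv : forall (j : tidx L) (e : tot L), triv j (bproj e) ->
    tinv j (bproj e) (fib j e) = e;
  lb_linear : forall (j k : tidx L) p, triv j p -> triv k p ->
    exists c, forall e : tot L, bproj e = p -> fib k e = c * fib j e;
  lb_total : complex_manifold (total_atlas A L) }.

Record line_bundle (R : realType) (T : topologicalType) (n : nat)
    (A : atlas R T n) := LineBundle {
  lb_data :> bundle_data R T;
  lb_axioms : is_line_bundle A lb_data }.

(* Equivalences cover the identity of the base. *)
Definition bundle_map (R : realType) (T : topologicalType) (n : nat)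
    (A : atlas R T n) (L1 L2 : line_bundle A) (F : tot L1 -> tot L2) : Prop :=
  [/\ holomorphic_map (total_atlas A L1) (total_atlas A L2) F,
      (forall e, bproj (F e) = bproj e) &
      forall (j : tidx L1) (k : tidx L2) p, triv j p -> triv k p ->
        exists c, forall e, bproj e = p -> fib k (F e) = c * fib j e].

Definition bundle_iso (R : realType) (T : topologicalType) (n : nat)
    (A : atlas R T n) (L1 L2 : line_bundle A) (F : tot L1 -> tot L2) : Prop :=
  bundle_map F /\
  exists G : tot L2 -> tot L1, [/\ bundle_map G, cancel F G & cancel G F].

Definition bundle_equiv (R : realType) (T : topologicalType) (n : nat)
    (A : atlas R T n) (L1 L2 : line_bundle A) : Prop :=
  exists F : tot L1 -> tot L2, bundle_iso F.

Lemma bundle_iso_id (R : realType) (T : topologicalType) (n : nat)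
  (A : atlas R T n) (L : line_bundle A) : bundle_iso (@id (tot L)).
Proof.
have H : bundle_map (@id (tot L)).
  split=> //; last exact: (lb_linear (lb_axioms L)).
  split; first by move=> x; exact: cvg_id.
  by move=> p i k; exact: (cm_compat (lb_total (lb_axioms L))).
by split=> //; exists id; split.
Qed.

Lemma bundle_equiv_refl (R : realType) (T : topologicalType) (n : nat)
  (A : atlas R T n) (L : line_bundle A) : bundle_equiv L L.
Proof. by exists id; exact: bundle_iso_id. Qed.

Lemma bundle_equiv_sym (R : realType) (T : topologicalType) (n : nat)
  (A : atlas R T n) (L1 L2 : line_bundle A) :
  bundle_equiv L1 L2 -> bundle_equiv L2 L1.
Proof. by move=> [F [hF [G [hG FG GF]]]]; exists G; split=> //; exists F. Qed.

Lemma bundle_map_comp (R : realType) (T : topologicalType) (n : nat)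
  (A : atlas R T n) (L1 L2 L3 : line_bundle A)
  (F : tot L1 -> tot L2) (G : tot L2 -> tot L3) :
  bundle_map F -> bundle_map G -> bundle_map (G \o F).
Proof.
move=> [Fh Fp Fl] [Gh Gp Gl]; split.
- by apply: holomorphic_comp Fh Gh; exact: lb_total (lb_axioms _).
- by move=> e; rewrite /= Gp Fp.
move=> j k p jp kp; have [l lp] := lb_cover (lb_axioms L2) p.
have [c hc] := Fl j l p jp lp; have [d hd] := Gl l k p lp kp.
by exists (d * c) => e ep; rewrite /= hd ?Fp// hc// mulrA.
Qed.

Lemma bundle_equiv_trans (R : realType) (T : topologicalType) (n : nat)
  (A : atlas R T n) (L1 L2 L3 : line_bundle A) :
  bundle_equiv L1 L2 -> bundle_equiv L2 L3 -> bundle_equiv L1 L3.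
Proof.
move=> [F [hF [F' [hF' FK KF]]]] [G [hG [G' [hG' GK KG]]]].
exists (G \o F); split; first exact: bundle_map_comp.
by exists (F' \o G'); split; [exact: bundle_map_comp | exact: can_comp..].
Qed.

Definition Pic (R : realType) (T : topologicalType) (n : nat)
    (A : atlas R T n) : Type :=
  {c : line_bundle A -> Prop | exists L, c = bundle_equiv L}.

(* The vertical field u d/du. *)
Definition euler (R : realType) (T : topologicalType) (n : nat)
    (A : atlas R T n) (L : bundle_data R T) : field_family (total_atlas A L) :=
  fun e ij => if `[< dom (total_atlas A L) ij e >]
    then row_mx 0 (const_mx (fib ij.2 e)) else 0.
Arguments euler {R T n} A L _ _.

Definition is_lift (R : realType) (T : topologicalType) (n : nat)
    (A : atlas R T n) (g : set (field_family A)) (L : line_bundle A)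
    (gh : set (field_family (total_atlas A L))) : Prop :=
  [/\ lie_algebra_of_vf gh,
      (forall X, gh X -> projectable A (@bproj R T L) X),
      (forall X, gh X -> bracket X (euler A L) = vf_zero _) &
      lie_isomorphism gh g (pushforward A (@bproj R T L))].

Record equivariant_bundle (R : realType) (T : topologicalType) (n : nat)
    (A : atlas R T n) (g : set (field_family A)) := EquivariantBundle {
  eb_bundle : line_bundle A;
  eb_lift : set (field_family (total_atlas A eb_bundle));
  eb_axiom : is_lift g eb_lift }.
Arguments eb_lift {R T n A g} e _.

Definition equivariant_equiv (R : realType) (T : topologicalType) (n : nat)
    (A : atlas R T n) (g : set (field_family A))
    (E1 E2 : equivariant_bundle g) : Prop :=
  exists F : tot (eb_bundle E1) -> tot (eb_bundle E2),
    bundle_iso F /\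
    pushforward (total_atlas A (eb_bundle E2)) F @` eb_lift E1 = eb_lift E2.

Definition Pic_equivariant (R : realType) (T : topologicalType) (n : nat)
    (A : atlas R T n) (g : set (field_family A)) : Type :=
  {c : equivariant_bundle g -> Prop | exists E, c = equivariant_equiv E}.

Lemma pushforward_id (R : realType) (T : topologicalType) (n : nat)
    (A : atlas R T n) (X : field_family A) :
  vector_field A X -> pushforward A id X = X.
Proof.
move=> VX; have [tX _] := VX; rewrite /pushforward; case: pselect => [pX|[]].
  case: (cid2 pX) => Y /= [tY _] rY.
  apply/funext => p; apply/funext => i; have [pi|npi] := pselect (dom A i p).
    by rewrite (rY p i i)//; apply/esym; exact: (tX p).2.
  by rewrite (tY p).1// (tX p).1.
by exists X => // p i k pi pk; exact: (tX p).2.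
Qed.

Lemma equivariant_equiv_refl (R : realType) (T : topologicalType) (n : nat)
    (A : atlas R T n) (g : set (field_family A)) (E : equivariant_bundle g) :
  equivariant_equiv E E.
Proof.
exists id; split; first exact: bundle_iso_id.
have [[gv _ _] _ _ _] := eb_axiom E.
apply/seteqP; split => [_ [X gX <-]|X gX]; first by rewrite pushforward_id//; exact: gv.
by exists X => //; rewrite pushforward_id//; exact: gv.
Qed.

Lemma forget_subproof (R : realType) (T : topologicalType) (n : nat)
    (A : atlas R T n) (g : set (field_family A)) (c : Pic_equivariant g) :
  exists L, (fun L => exists2 E, sval c E & bundle_equiv (eb_bundle E) L) =
    bundle_equiv L.
Proof.
case: c => c /= [E ->]; exists (eb_bundle E); apply/funext => L.
apply/propext; split=> [[E' [F [isoF _]]]|EL].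
  by apply: bundle_equiv_trans; exists F.
by exists E => //; exact: equivariant_equiv_refl.
Qed.

(* The class of [E] is sent to the class of the bundle underlying [E]. *)
Definition forget (R : realType) (T : topologicalType) (n : nat)
    (A : atlas R T n) (g : set (field_family A)) (c : Pic_equivariant g) :
    Pic A :=
  exist _ _ (forget_subproof c).
Arguments forget {R T n A} g c.

(* A [k]-form at a point is a function of [k] tangent vectors, each given by its
   coordinates, in each chart. *)
Definition form_family (R : realType) (T : topologicalType) (n : nat)
    (A : atlas R T n) (k : nat) : Type :=
  T -> idx A -> ('I_k -> 'rV[Cplx R]_n) -> (Cplx R)^o.

Definition upd (k : nat) (V : Type) (v : 'I_k -> V) (a : 'I_k) (x : V) :
    'I_k -> V :=
  fun b => if b == a then x else v b.

(* Sections of the sheaf of holomorphic [k]-forms over the open set [U]; the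
   values outside [U] are irrelevant. *)
Record holomorphic_form (R : realType) (T : topologicalType) (n : nat)
    (A : atlas R T n) (k : nat) (U : set T) (w : form_family A k) : Prop :=
    HolomorphicForm {
  hf_linear : forall p i v a (c : Cplx R) x y, U p -> dom A i p ->
    w p i (upd v a (c *: x + y)) =
    c * w p i (upd v a x) + w p i (upd v a y);
  hf_alternating : forall p i v a b, U p -> dom A i p ->
    a != b -> v a = v b -> w p i v = 0;
  hf_compat : forall p i j v, U p -> dom A i p -> dom A j p ->
    w p i v =
    w p j (fun a => 'd (crd A j \o crd_inv A i) (crd A i p) (v a));
  hf_holomorphic : forall p i v, U p -> dom A i p ->
    differentiable (fun z => w (crd_inv A i z) i v) (crd A i p) }.

(* (dw)(v_0,...,v_k) = \sum_a (-1)^a D_{v_a} w(v_0,...,^v_a,...,v_k), for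
   constant vectors v_0,...,v_k in a chart. *)
Definition exterior_d (R : realType) (T : topologicalType) (n : nat)
    (A : atlas R T n) (k : nat) (w : form_family A k) : form_family A k.+1 :=
  fun p i v => \sum_(a < k.+1) (-1) ^+ a *
    'd (fun z => w (crd_inv A i z) i (v \o lift a)) (crd A i p) (v a).

(* Hypercohomology of the complex of sheaves of holomorphic forms is computed
   by Cech hypercohomology, the colimit over the open covers of the cohomology
   of the total complex of the double complex C^a(U, Omega^b); on a manifold,
   which is paracompact, it agrees with the derived functor definition. *)

Definition open_cover (T : topologicalType) (I : Type) (U : I -> set T) : Prop :=
  (forall i, open (U i)) /\ forall p, exists i, U i p.

Definition inter (T : topologicalType) (I : Type) (U : I -> set T) (a : nat)
    (s : 'I_a.+1 -> I) : set T :=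
  [set p | forall l, U (s l) p].

Definition cochain_family (R : realType) (T : topologicalType) (n : nat)
    (A : atlas R T n) (I : Type) : Type :=
  forall a b : nat, ('I_a.+1 -> I) -> form_family A b.

(* Cochains concentrated in the total degrees satisfying [deg]. *)
Definition cochain (R : realType) (T : topologicalType) (n : nat)
    (A : atlas R T n) (I : Type) (U : I -> set T) (deg : pred nat)
    (c : cochain_family A I) : Prop :=
  forall a b (s : 'I_a.+1 -> I),
    holomorphic_form (inter U s) (c a b s) /\
    (~~ deg (a + b)%N -> forall p i v, inter U s p -> dom A i p ->
       c a b s p i v = 0).

Definition cech_d (R : realType) (T : topologicalType) (n : nat)
    (A : atlas R T n) (I : Type) (a b : nat)
    (c : ('I_a.+1 -> I) -> form_family A b) (s : 'I_a.+2 -> I) :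
    form_family A b :=
  fun p i v => \sum_(l < a.+2) (-1) ^+ l * c (s \o lift l) p i v.

(* The total differential, with component (a, b) given by
   cech_d c^(a-1, b) + (-1)^a exterior_d c^(a, b-1). *)
Definition total_d (R : realType) (T : topologicalType) (n : nat)
    (A : atlas R T n) (I : Type) (c : cochain_family A I) :
    cochain_family A I :=
  fun a b s p i v =>
    match a return ('I_a.+1 -> I) -> (Cplx R)^o with
    | 0 => fun=> 0
    | a'.+1 => fun s => cech_d (c a' b) s p i v
    end s +
    match b return ('I_b -> 'rV[Cplx R]_n) -> (Cplx R)^o with
    | 0 => fun=> 0
    | b'.+1 => fun v => (-1) ^+ a * exterior_d (c a b' s) p i v
    end v.

(* H^k_dR = 0: every [k]-cocycle on an open cover becomes a coboundary on some
   refinement.  For [k = 0] the cochain [e] vanishes. *)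
Definition deRham_trivial (R : realType) (T : topologicalType) (n : nat)
    (A : atlas R T n) (k : nat) : Prop :=
  forall (I : Type) (U : I -> set T) (c : cochain_family A I),
    open_cover U ->
    cochain U (fun d => d == k) c ->
    (forall a b (s : 'I_a.+1 -> I) p i v, inter U s p -> dom A i p ->
       total_d c (b := b) s p i v = 0) ->
    exists (J : Type) (V : J -> set T) (r : J -> I) (e : cochain_family A J),
      [/\ open_cover V, (forall j, V j `<=` U (r j)),
          cochain V (fun d => d.+1 == k) e &
          forall a b (s : 'I_a.+1 -> J) p i v, inter V s p -> dom A i p ->
            c a b (r \o s) p i v = total_d e s p i v].
Arguments deRham_trivial {R T n} A k.

(* Main.v *)
From HB Require Import structures.
Require Import Defs.
From mathcomp Require Import all_boot all_order all_algebra perm.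
From mathcomp Require Import complex ring lra.
From mathcomp Require Import all_classical all_reals all_analysis.

Set Implicit Arguments.
Unset Strict Implicit.
Unset Printing Implicit Defensive.

Import Order.TTheory GRing.Theory Num.Theory.
Import numFieldNormedType.Exports.

Local Open Scope classical_set_scope.
Local Open Scope ring_scope.

(** Two lifts of [g] to equivalent line bundles are compared along an
    equivalence [F], and [F] is rescaled until it carries one to the other.

    A lift of a field commutes with the Euler field; along a fiber this is
    Euler's relation for the vertical component, which is therefore
    [u beta(X) d/du] in a trivialization, with [beta(X)] holomorphic on the
    base ([lift_form]).  For trivializations [j] of the first bundle and [k]
    of the second, the defect [beta2(X) - beta1(X)] is a 1-cocycle of [g] with
    values in the holomorphic functions ([defect_bracket]).  On the isotropy
    algebra of a point [p], its value at [p] is a linear form that vanishes on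
    brackets; a nonzero one would have as kernel an ideal of codimension 1, so
    it is zero ([defect_isotropy]).  By transitivity the defect at [p] is then
    a function of the tangent vector [X p], that is a 1-form; it is
    holomorphic because fields of [g] provide local frames, and closed by the
    cocycle identity ([dform_differentiable], [dform_closed]).

    If [c] is the matrix of [F] in the trivializations, changing them changes
    the 1-form by the differential of the change of [log c]
    ([defect_invariant]).  The forms and the differences of the [log c] thus
    make up a Cech-de Rham 1-cocycle.  Since [H^1 = 0] there are functions [f]
    whose differentials are the forms and such that [f - log c] is globally
    defined; with [h = exp (f - log c)], the map [h F] has matrix
    proportional to [exp f] and sends the first lift to the second
    ([rescaling_factor], [equivariant_of_bundle_equiv]).  So equivariant
    bundles with equivalent underlying bundles are equivalent.

    The reason for the Cech form of the cocycle is that holomorphic means here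
    complex differentiable.  The forms [beta2 - beta1] are holomorphic because
    the lifts are, whereas for the global 1-form [beta2 - beta1 - dc/c] one
    would have to differentiate [dc]; in the Cech form the derivatives of [c]
    and of the transition functions only occur to first order. *)

(** * Identities in groups and fields *)

Lemma subr_eq0_0 (V : zmodType) (a b : V) : a = 0 -> b = 0 -> a - b = 0.
Proof. by move=> -> ->; exact: subr0. Qed.

Lemma subr_subACA (V : zmodType) (a b c d : V) : a - b - (c - d) = a - c - (b - d).
Proof. by rewrite !opprD !opprK addrACA. Qed.

Lemma sub_add_cancel (V : zmodType) (a b c d : V) :
  a - b = a + c - (b + d) -> c - d = 0.
Proof.
by move=> E; apply: (addrI (a - b)); rewrite addr0 [RHS]E opprD addrACA.
Qed.

Lemma telescope3 (V : zmodType) (x y z : V) : x - y + (z - x + (y - z)) = 0.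
Proof.
by rewrite (addrC (z - x)) addrA (addrA (x - y)) subrK addrA subrK subrr.
Qed.

(** [u], [u'] stand for the matrices of a bundle map in two pairs of
    trivializations, [v1], [v2] for the changes of trivialization of source and
    target; [a], [a'], [a1], [a2] are their derivatives along a vector, and the
    [b]s are the vertical parts of two lifts. *)
Lemma log_derivative_change (K : fieldType) (u u' v1 v2 a a' a1 a2 b1 b1' b2 b2' : K) :
  u != 0 -> u' != 0 -> v1 != 0 -> v2 != 0 -> u' * v1 = v2 * u ->
  v1 * b1' = a1 + v1 * b1 -> v2 * b2' = a2 + v2 * b2 ->
  v2 * a + u * a2 = u' * a1 + v1 * a' ->
  b2' - b1' - u'^-1 * a' = b2 - b1 - u^-1 * a.
Proof.
move=> u0 u'0 v10 v20 E E1 E2 E3.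
have -> : b1' = a1 / v1 + b1 by apply: (mulfI v10); rewrite E1; field.
have -> : b2' = a2 / v2 + b2 by apply: (mulfI v20); rewrite E2; field.
have -> : a' = (v2 * a + u * a2 - u' * a1) / v1.
  by apply: (mulfI v10); rewrite E3; field.
have -> : u' = v2 * u / v1 by apply: (mulIf v10); rewrite E; field.
by field; rewrite u0 v10 v20.
Qed.

(** [c] is the matrix of an equivalence and [d] its derivative along a field;
    the left-hand side is the vertical component, at the point of coordinate
    [u], of the image of the first lift under the equivalence rescaled by [h]. *)
Lemma rescaled_derivative (K : fieldType) (h c d b1 b2 u : K) : c != 0 ->
  u * (h * d + c * (h * (b2 - b1 - c^-1 * d))) + h * c * (u * b1) = h * c * u * b2.
Proof. by move=> c0; field. Qed.

(** * Calculus in coordinates *)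

Section Calculus.
Context {K : numFieldType}.
Implicit Types V W : normedModType K.

(** Differentials are computed through [is_diff] statements, which carry the
    value of the differential along with differentiability. *)
Lemma near_eq_is_diff V W (f g df : V -> W) (x : V) :
  (\forall z \near x, f z = g z) -> is_diff x f df -> is_diff x g df.
Proof.
move=> fg [fx dfE]; have gx := near_eq_diff fg fx.
apply: DiffDef => //; rewrite -dfE; apply/funext => v.
have [->|v0] := eqVneq v 0; first by rewrite !linear0.
rewrite -(deriveE v gx) -(deriveE v fx); apply: near_eq_derive => //.
by apply: filterS fg => z ->.
Qed.

Lemma eq_is_diff V W (f df df' : V -> W) (x : V) :
  is_diff x f df -> (forall v, df v = df' v) -> is_diff x f df'.
Proof. by move=> H /funext <-. Qed.

Lemma diff_eq0 V W (f : V -> W) (x v : V) :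
  v = 0 -> 'd f x v = 0.
Proof. by move=> ->; exact: linear0. Qed.

Lemma is_diffP V W (f : V -> W) (x : V) :
  differentiable f x -> is_diff x f ('d f x).
Proof. by move=> fx; apply: DiffDef. Qed.

Lemma is_diffE V W (f df : V -> W) (x v : V) : is_diff x f df -> 'd f x v = df v.
Proof. by move=> [_ ->]. Qed.

Lemma is_diff_ex V W (f df : V -> W) (x : V) : is_diff x f df -> differentiable f x.
Proof. by case. Qed.

Lemma is_diff_compE (U : normedModType K) V W (f df : U -> V) (g dg : V -> W) x y :
  f x = y -> is_diff x f df -> is_diff y g dg ->
  is_diff x (fun z => g (f z)) (fun v => dg (df v)).
Proof. by move=> <- Hf Hg; exact: (is_diff_comp Hf Hg). Qed.

(** Expanding the argument in the canonical basis gives continuity, and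
    hence differentiability. *)
Lemma is_diff_lin_rV n W (f : {linear 'rV[K]_n -> W}) (x : 'rV[K]_n) :
  is_diff x f f.
Proof.
have df y : differentiable f y.
  have -> : (f : _ -> _) = \sum_(j < n) (fun z : 'rV[K]_n => z 0 j *: f (delta_mx 0 j)).
    apply/funext => z; rewrite fct_sumE {1}(row_sum_delta z) linear_sum.
    by apply: eq_bigr => j _; rewrite linearZ.
  apply: differentiable_sum => j; apply: (@differentiableZl _ _ _ (fun z : 'rV[K]_n => z 0 j : K)).
  exact: differentiable_coord.
apply: DiffDef => //; apply: diff_lin => y.
exact: differentiable_continuous.
Qed.

Lemma is_diff_coord V m n (f df : V -> 'M[K]_(m, n)) (x : V) i j :
  is_diff x f df -> is_diff x (fun y => f y i j : K) (fun v => df v i j : K).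
Proof.
move=> H; apply: (@is_diff_comp _ _ _ _ f df (fun N : 'M[K]_(m, n) => N i j : K) (fun N : 'M[K]_(m, n) => N i j : K)).
apply: DiffDef; first exact: differentiable_coord.
pose g (N : 'M[K]_(m, n)) : K := N i j.
have gl : linear g by move=> a u v; rewrite /g !mxE.
pose gM := GRing.isLinear.Build _ _ _ _ _ gl.
pose gL : {linear _ -> _} := HB.pack g gM.
exact: (@diff_lin _ _ _ gL _ (@coord_continuous K m n i j)).
Qed.

Lemma differentiable_rV V n (f : V -> 'rV[K]_n) (x : V) :
  (forall j, differentiable (fun y => f y 0 j : K) x) -> differentiable f x.
Proof.
move=> H; have -> : f = \sum_(j < n) (fun y => f y 0 j *: (delta_mx 0 j : 'rV[K]_n)).
  by apply/funext => y; rewrite fct_sumE {1}(row_sum_delta (f y)).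
by apply: differentiable_sum => j; apply: (@differentiableZl _ _ _ (fun y => f y 0 j : K)).
Qed.

Lemma is_diff_rV V n (f df : V -> 'rV[K]_n) (x : V) :
  (forall j, is_diff x (fun y => f y 0 j : K) (fun v => df v 0 j : K)) -> is_diff x f df.
Proof.
move=> H; have fx : differentiable f x.
  by apply: differentiable_rV => j; have [] := H j.
apply: DiffDef => //; apply/funext => v; apply/rowP => j.
have [_ E] := H j; have [_ E'] := is_diff_coord 0 j (is_diffP fx).
by have := congr1 (@^~ v) (etrans (esym E') E).
Qed.

Lemma is_diff_row_mx V n1 n2 (f df : V -> 'rV[K]_n1) (g dg : V -> 'rV[K]_n2) (x : V) :
  is_diff x f df -> is_diff x g dg ->
  is_diff x (fun y => row_mx (f y) (g y)) (fun v => row_mx (df v) (dg v)).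
Proof.
move=> Hf Hg; apply: is_diff_rV => j; case: (split_ordP j) => k ->.
  under eq_fun do rewrite row_mxEl; under [X in is_diff _ _ X]eq_fun do rewrite row_mxEl.
  exact: is_diff_coord.
under eq_fun do rewrite row_mxEr; under [X in is_diff _ _ X]eq_fun do rewrite row_mxEr.
exact: is_diff_coord.
Qed.

Lemma is_diff_const_mx V n (f df : V -> K) (x : V) :
  is_diff x f df ->
  is_diff x (fun y => const_mx (f y) : 'rV[K]_n) (fun v => const_mx (df v)).
Proof.
move=> H; apply: is_diff_rV => j.
by under eq_fun do rewrite mxE; under [X in is_diff _ _ X]eq_fun do rewrite mxE.
Qed.

Lemma is_diff_lsubmx n1 n2 (x : 'rV[K]_(n1 + n2)) : is_diff x lsubmx lsubmx.
Proof. exact: is_diff_lin_rV. Qed.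

Lemma is_diff_mul V (f g df dg : V -> K) (x : V) :
  is_diff x f df -> is_diff x g dg ->
  is_diff x (fun y => f y * g y) (fun v => f x * dg v + g x * df v).
Proof. by move=> *; apply: is_diffM. Qed.

Lemma is_diff_inv V (f df : V -> K) (x : V) :
  is_diff x f df -> f x != 0 ->
  is_diff x (fun y => (f y)^-1) (fun v => - (df v / f x ^+ 2)).
Proof.
move=> [fx E] fx0; apply: DiffDef; first exact: differentiableV.
by rewrite diffV //; apply/funext => v /=; rewrite E /GRing.scale /= mulNr mulrC.
Qed.

Lemma differentiable_big_sum V W (I : Type) (r : seq I) (P : pred I) (f : I -> V -> W) (x : V) :
  (forall i, differentiable (f i) x) ->
  differentiable (fun y => \sum_(i <- r | P i) f i y) x.
Proof.
move=> H; elim: r => [|i r IH].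
  by under eq_fun do rewrite big_nil; exact: differentiable_cst.
under eq_fun do rewrite big_cons; case: (P i) => //.
by apply: (differentiableD (H i)).
Qed.

Lemma is_diff_big_sum V W (I : Type) (r : seq I) (f df : I -> V -> W) (x : V) :
  (forall i, is_diff x (f i) (df i)) ->
  is_diff x (fun y => \sum_(i <- r) f i y) (fun v => \sum_(i <- r) df i v).
Proof.
move=> H; elim: r => [|i r IH].
  under eq_fun do rewrite big_nil; under [X in is_diff _ _ X]eq_fun do rewrite big_nil.
  exact: (is_diff_cst (0 : W)).
under eq_fun do rewrite big_cons; under [X in is_diff _ _ X]eq_fun do rewrite big_cons.
exact: (is_diffD (H i) IH).
Qed.

Lemma differentiable_big_prod V (I : Type) (r : seq I) (P : pred I) (f : I -> V -> K) (x : V) :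
  (forall i, differentiable (f i) x) ->
  differentiable (fun y => \prod_(i <- r | P i) f i y) x.
Proof.
move=> H; elim: r => [|i r IH].
  by under eq_fun do rewrite big_nil; exact: differentiable_cst.
under eq_fun do rewrite big_cons; case: (P i) => //.
by apply: (differentiableM (H i)).
Qed.

Lemma differentiable_det V n (N : V -> 'M[K]_n) (x : V) :
  (forall i j, differentiable (fun y => N y i j : K) x) ->
  differentiable (fun y => \det (N y) : K) x.
Proof.
move=> H; apply: differentiable_big_sum => s.
apply: (@differentiableM _ _ (cst _) (fun y => \prod_i N y i (s i))).
  exact: differentiable_cst.
by apply: differentiable_big_prod => i.
Qed.

(** By Cramer's rule the solution [a] is near [x] a rational function of the
    entries of [N] and [b]. *)
Lemma differentiable_solve V n (N : V -> 'M[K]_n) (a b : V -> 'cV[K]_n) (x : V) :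
  (forall i j, differentiable (fun y => N y i j : K) x) ->
  (forall i, differentiable (fun y => b y i 0 : K) x) ->
  \det (N x) != 0 ->
  (\forall y \near x, N y *m a y = b y) ->
  forall i, differentiable (fun y => a y i 0 : K) x.
Proof.
move=> HN Hb N0 E i; have dN := differentiable_det HN.
have near0 : \forall y \near x, \det (N y) != 0.
  have := differentiable_continuous dN; rewrite /continuous_at => /cvgr_neq0.
  exact.
apply: (@near_eq_diff _ _ _ (fun y => (\det (N y))^-1 * \sum_j (\adj (N y)) i j * b y j 0)).
  near=> y; have dy : \det (N y) != 0 by near: y.
  have Ey : N y *m a y = b y by near: y.
  have := congr1 (fun c => (\adj (N y) *m c) i 0) Ey.
  rewrite mulmxA mul_adj_mx mul_scalar_mx mxE [X in _ = X]mxE => <-.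
  by rewrite mulKf.
apply: (@differentiableM _ _ (fun y => (\det (N y))^-1)).
  exact: (@differentiableV _ _ (fun y => \det (N y))).
apply: differentiable_big_sum => j.
apply: (@differentiableM _ _ (fun y => (\adj (N y)) i j)) => //.
under eq_fun do rewrite mxE /cofactor.
apply: (@differentiableM _ _ (cst _)); first exact: differentiable_cst.
apply: differentiable_det => k l.
under eq_fun do rewrite !mxE.
exact: HN.
Unshelve. all: by end_near. Qed.

End Calculus.

(** * The complex exponential and logarithm *)

Section ComplexExponential.
Variable R : realType.
Local Notation C := (Cplx R).
Local Notation Re z := (@complex.Re R z).
Local Notation Im z := (@complex.Im R z).
Implicit Types z w : C.

Definition embC (x : R) : C := real_complex R x.

Lemma ler_ReC z : embC `|Re z| <= `|z|.
Proof. exact: normc_ge_Re. Qed.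

Lemma ler_ImC z : embC `|Im z| <= `|z|.
Proof.
case: z => a b; rewrite /embC normc_def /= lecR -sqrtr_sqr ler_wsqrtr //.
by rewrite lerDr sqr_ge0.
Qed.

Lemma normC_ler z : `|z| <= embC (`|Re z| + `|Im z|).
Proof.
case: z => a b; rewrite /embC normc_def /= lecR.
rewrite -[leRHS]ger0_norm ?addr_ge0 // -sqrtr_sqr ler_wsqrtr //.
rewrite sqrrD !real_normK ?num_real //.
by rewrite addrAC lerDl mulrn_wge0 // mulr_ge0.
Qed.

Lemma posC_emb (e : C) : 0 < e -> exists2 r : R, 0 < r & e = embC r.
Proof.
case: e => a b; rewrite ltcE /= => /andP[/eqP -> a0].
by exists a.
Qed.

Lemma continuous_Re : continuous (@complex.Re R : C -> R).
Proof.
move=> z; rewrite /continuous_at; apply/(@cvgrPdist_lt _ _ _ (nbhs (z : C))) => e e0.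
have : \forall y \near z, `|z - y| < embC e by apply/nbhs_normP; exists (embC e); rewrite //= ltcR.
move=> small; near=> y.
have -> : @complex.Re R z - @complex.Re R y = Re (z - y) by case: (z) (y) => ? ? [? ?].
by rewrite -ltcR; apply: (le_lt_trans (ler_ReC (z - y))); near: y.
Unshelve. all: by end_near. Qed.

Lemma continuous_Im : continuous (@complex.Im R : C -> R).
Proof.
move=> z; rewrite /continuous_at; apply/(@cvgrPdist_lt _ _ _ (nbhs (z : C))) => e e0.
have : \forall y \near z, `|z - y| < embC e by apply/nbhs_normP; exists (embC e); rewrite //= ltcR.
move=> small; near=> y.
have -> : @complex.Im R z - @complex.Im R y = Im (z - y) by case: (z) (y) => ? ? [? ?].
by rewrite -ltcR; apply: (le_lt_trans (ler_ImC (z - y))); near: y.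
Unshelve. all: by end_near. Qed.

Lemma continuous_complex (T : topologicalType) (f : T -> C) (x : T) :
  {for x, continuous (fun y => Re (f y))} -> {for x, continuous (fun y => Im (f y))} ->
  {for x, continuous f}.
Proof.
move=> fR fI; apply/cvgrPdist_lt => _ /posC_emb[e e0 ->].
have e20 : 0 < e / 2 by rewrite divr_gt0.
have HR : \forall y \near x, `|Re (f x) - Re (f y)| < e / 2 by move/cvgrPdist_lt: fR; exact.
have HI : \forall y \near x, `|Im (f x) - Im (f y)| < e / 2 by move/cvgrPdist_lt: fI; exact.
near=> y; apply: (le_lt_trans (normC_ler _)); rewrite ltcR [e]splitr.
have -> : Re (f x - f y) = Re (f x) - Re (f y) by case: (f x) (f y) => ? ? [].
have -> : Im (f x - f y) = Im (f x) - Im (f y) by case: (f x) (f y) => ? ? [].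
by apply: ltrD; near: y.
Unshelve. all: by end_near. Qed.

Lemma is_derive_littleo (f : R -> R) (x d : R) : is_derive x 1 f d ->
  forall e, 0 < e -> \forall h \near 0, `|f (h + x) - f x - h * d| <= e * `|h|.
Proof.
move=> [/derivable1_diffP fx E] e e0.
have /eqaddoP /(_ e e0) := diff_locally fx.
apply: filterS => h; rewrite !fctE /=.
rewrite deriveE // in E.
have -> : 'd f x h = h * d by rewrite -[h in LHS]mulr1 -/(h *: 1) linearZ /= E.
by rewrite opprD addrA.
Qed.

Definition cexp z : C := Complex (expR (Re z) * cos (Im z)) (expR (Re z) * sin (Im z)).

Lemma cexpD z w : cexp (z + w) = cexp z * cexp w.
Proof.
case: z w => [a b] [c d]; rewrite /cexp /= expRD cosD sinD.
by apply/eqP; rewrite eq_complex /=; apply/andP; split; apply/eqP; ring.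
Qed.

Lemma cexp0 : cexp 0 = 1.
Proof. by rewrite /cexp /= expR0 cos0 sin0 mulr1 mulr0. Qed.

Lemma cexp_neq0 z : cexp z != 0.
Proof.
apply/eqP => z0; have := cexpD z (- z).
by rewrite subrr cexp0 z0 mul0r => /eqP; rewrite oner_eq0.
Qed.

(** Follows from the first order expansions of the real exponential, sine and
    cosine at 0, applied to the real and imaginary parts. *)
Lemma cexp_littleo (e : R) : 0 < e ->
  \forall h \near (0 : C), `|cexp h - 1 - h| <= embC e * `|h|.
Proof.
(* Each part is bounded by [8 d] times the sum of the absolute values of the
   two parts of [h], and each of these is at most the norm of [h]. *)
move=> e0; pose d := Num.min (e / 16) 1.
have d0 : 0 < d by rewrite /d lt_min ltr01 divr_gt0.
have d1 : d <= 1 by rewrite /d ge_min lexx orbT.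
have de : 16 * d <= e.
  by rewrite mulrC -ler_pdivlMr // /d ge_min lexx.
have E : \forall x \near (0 : R), `|expR x - 1 - x| <= d * `|x|.
  have := is_derive_littleo (is_derive_expR (0 : R)) d0.
  by apply: filterS => h; rewrite addr0 expR0 mulr1.
have S : \forall y \near (0 : R), `|sin y - y| <= d * `|y|.
  have := is_derive_littleo (is_derive_sin (0 : R)) d0.
  by apply: filterS => h; rewrite addr0 cos0 sin0 mulr1 subr0.
have Co : \forall y \near (0 : R), `|cos y - 1| <= d * `|y|.
  have := is_derive_littleo (is_derive_cos (0 : R)) d0.
  by apply: filterS => h; rewrite addr0 cos0 sin0 oppr0 mulr0 subr0.
have small : \forall x \near (0 : R), `|x| <= d.
  by apply/nbhs_normP; exists d => //= x; rewrite /ball_ /= sub0r normrN => /ltW.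
have nR (P : R -> Prop) : (\forall x \near (0 : R), P x) -> \forall h \near (0 : C), P (Re h).
  by move=> HP; exact: (@continuous_Re (0 : C) _ HP).
have nI (P : R -> Prop) : (\forall x \near (0 : R), P x) -> \forall h \near (0 : C), P (Im h).
  by move=> HP; exact: (@continuous_Im (0 : C) _ HP).
have E1 := nR _ E; have S1 := nI _ S; have Co1 := nI _ Co.
have small1 := nR _ small; near=> h.
have hE : `|expR (Re h) - 1 - Re h| <= d * `|Re h| by near: h.
have hS : `|sin (Im h) - Im h| <= d * `|Im h| by near: h.
have hC : `|cos (Im h) - 1| <= d * `|Im h| by near: h.
have hs : `|Re h| <= d by near: h.
apply: (le_trans (normC_ler _)).
suff K : `|Re (cexp h - 1 - h)| + `|Im (cexp h - 1 - h)| <= 8 * d * (`|Re h| + `|Im h|).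
  apply: (@le_trans _ _ (embC (8 * d * (`|Re h| + `|Im h|)))); first by rewrite lecR.
  apply: (@le_trans _ _ (embC (8 * d) * (`|h| + `|h|))).
    rewrite /embC rmorphM ler_wpM2l ?ler0c ?mulr_ge0 ?(ltW d0) // rmorphD.
    by apply: lerD; [exact: ler_ReC | exact: ler_ImC].
  rewrite mulrDr -mulrDl -rmorphD ler_wpM2r // lecR.
  by move: de; lra.
move: hE hS hC hs; rewrite /cexp; case: (h) => x y /= hE hS hC hs.
set A := expR x in hE *; set c := cos y in hC *; set s := sin y in hS *.
have -> : A * c - 1 - x = (A - 1 - x) * c + (1 + x) * (c - 1) by ring.
have -> : A * s - 0 - y = (A - 1 - x + (1 + x)) * (s - y) + ((A - 1 - x) + x) * y by ring.
have c1 : `|c| <= 1 by rewrite ler_norml cos_geN1 cos_le1.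
set a := A - 1 - x in hE *.
have hx : `|x| >= 0 by []. have hy : `|y| >= 0 by [].
have h1x : `|1 + x| <= 2 by apply: (le_trans (ler_normD _ _)); rewrite normr1; lra.
have ad : `|a| <= d * d.
  by apply: (le_trans hE); rewrite ler_wpM2l // ltW.
have t1 : `|a * c| <= d * `|x|.
  by rewrite normrM; apply: (le_trans _ hE); rewrite ler_piMr.
have t2 : `|(1 + x) * (c - 1)| <= 2 * (d * `|y|).
  by rewrite normrM; apply: ler_pM.
have t3 : `|(a + (1 + x)) * (s - y)| <= 3 * (d * `|y|).
  rewrite normrM; apply: ler_pM => //; apply: (le_trans (ler_normD _ _)).
  by nra.
have t4 : `|(a + x) * y| <= 2 * (d * `|y|).
  rewrite normrM mulrA ler_wpM2r //; apply: (le_trans (ler_normD _ _)).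
  by nra.
have := ler_normD (a * c) ((1 + x) * (c - 1)).
have := ler_normD ((a + (1 + x)) * (s - y)) ((a + x) * y).
have : 0 <= d * `|x| by rewrite mulr_ge0 // ltW.
have : 0 <= d * `|y| by rewrite mulr_ge0 // ltW.
by lra.
Unshelve. all: by end_near. Qed.

Lemma is_diff_littleo (f : C -> C) (x d : C) :
  (forall e : R, 0 < e ->
     \forall h \near (0 : C), `|f (h + x) - f x - d * h| <= embC e * `|h|) ->
  is_diff x f (fun h : C => d * h).
Proof.
move=> H; pose df : {linear C -> C} := *:%R d.
have dfc : continuous df by apply: scaler_continuous.
have key : f \o shift x = cst (f x) + df +o_ 0 id.
  apply/eqaddoP => _ /posC_emb[e e0 ->].
  by apply: filterS (H e e0) => h; rewrite !fctE /= opprD addrA.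
have E := diff_unique dfc key.
apply: DiffDef; last by rewrite E.
by apply/diff_locallyP; rewrite E.
Qed.

(** Additivity transports the expansion at 0 to every point. *)
Lemma is_diff_cexp z : is_diff z (cexp : C -> C) (fun h : C => cexp z * h).
Proof.
apply: is_diff_littleo => e e0.
have n0 : 0 < complex.Re `|cexp z|.
  by have := cexp_neq0 z; rewrite -normr_gt0 ltcE => /andP[].
have e'0 : 0 < e / complex.Re `|cexp z| by rewrite divr_gt0.
apply: filterS (cexp_littleo e'0) => h H.
have -> : cexp (h + z) - cexp z - cexp z * h = cexp z * (cexp h - 1 - h).
  by rewrite cexpD; ring.
rewrite normrM; apply: (le_trans (ler_wpM2l _ H)) => //.
rewrite mulrA ler_wpM2r //.
have -> : `|cexp z| = embC (complex.Re `|cexp z|).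
  by rewrite /embC RRe_real // normr_real.
by rewrite -rmorphM lecR mulrC divfK // gt_eqF.
Qed.

(** The principal branch, on the half plane [0 < Re z]. *)
Definition clog z : C :=
  Complex (ln (Num.sqrt (Re z ^+ 2 + Im z ^+ 2))) (atan (Im z / Re z)).

Lemma clogK z : 0 < Re z -> cexp (clog z) = z.
Proof.
case: z => a b /= a0; rewrite /cexp /clog /=.
have p0 : 0 < a ^+ 2 + b ^+ 2 by rewrite ltr_wpDr ?sqr_ge0 // exprn_gt0.
have s0 : 0 < Num.sqrt (a ^+ 2 + b ^+ 2) by rewrite sqrtr_gt0.
rewrite lnK ?posrE //.
have E : Num.sqrt (a ^+ 2 + b ^+ 2) = a * Num.sqrt (1 + (b / a) ^+ 2).
  rewrite -[X in _ = X * _](ger0_norm (ltW a0)) -sqrtr_sqr -sqrtrM ?sqr_ge0 //.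
  by congr Num.sqrt; field; rewrite gt_eqF.
have q0 : Num.sqrt (1 + (b / a) ^+ 2) != 0.
  by rewrite gt_eqF // sqrtr_gt0 ltr_wpDr // sqr_ge0.
have c : Num.sqrt (a ^+ 2 + b ^+ 2) * cos (atan (b / a)) = a.
  by rewrite cos_atan E mulfK.
have cn : cos (atan (b / a)) != 0 by apply/eqP => c0; move: c; rewrite c0 mulr0 => /eqP; rewrite lt_eqF.
congr Complex => //.
rewrite -[sin _](divfK cn) -/(tan _) atanK mulrCA c divfK // gt_eqF //.
Qed.

Lemma continuous_clog z : 0 < Re z -> {for z, continuous (clog : C -> C)}.
Proof.
move=> z0; apply: continuous_complex => /=.
  apply: (@continuous_comp _ _ _ (fun y : C => Num.sqrt (Re y ^+ 2 + Im y ^+ 2)) (@ln R)).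
    apply: (@continuous_comp _ _ _ (fun y : C => Re y ^+ 2 + Im y ^+ 2) (@Num.sqrt R)).
      exact: (cvgD (cvgM (@continuous_Re z) (@continuous_Re z)) (cvgM (@continuous_Im z) (@continuous_Im z))).
    exact: sqrt_continuous.
  by apply: continuous_ln; rewrite sqrtr_gt0 ltr_wpDr ?sqr_ge0 // exprn_gt0.
apply: (@continuous_comp _ _ _ (fun y : C => Im y / Re y) (@atan R)).
  by apply: (cvgM (@continuous_Im z)); apply: cvgV; [rewrite gt_eqF | exact: continuous_Re].
exact: continuous_atan.
Qed.

End ComplexExponential.
Arguments cexp {R} _.
Arguments clog {R} _.
Arguments embC {R} _.

Section ComplexDerivative.
Variable R : realType.
Local Notation C := (Cplx R).
Local Notation Re z := (@complex.Re R z).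
Local Notation Im z := (@complex.Im R z).
Implicit Types z w : C.

(** The increment [k] of the logarithm tends to 0 with [h] by continuity, and
    [cexp k = 1 + h / z]; the expansion of [cexp] at 0 then compares [k] with
    [h / z]. *)
Lemma is_diff_clog z : 0 < Re z -> is_diff z (clog : C -> C) (fun h : C => z^-1 * h).
Proof.
move=> z0; have zn : z != 0 by apply/eqP => E; move: z0; rewrite E /= ltxx.
apply: is_diff_littleo => e e0.
pose N (w : C) : R := complex.Re `|w|.
have NE (w : C) : `|w| = embC (N w) by rewrite /embC RRe_real // normr_real.
have Nz : 0 < N z.
  by have : 0 < embC (N z) by [rewrite -NE normr_gt0]; rewrite ltcR.
have Nge (w : C) : 0 <= N w.
  by have : 0 <= embC (N w) by [rewrite -NE normr_ge0]; rewrite lecR.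
pose d := Num.min (2^-1) (e * N z / 2).
have d0 : 0 < d by rewrite /d lt_min invr_gt0 ltr0n /= divr_gt0 // mulr_gt0.
have d2 : d <= 2^-1 by rewrite /d ge_min lexx.
have de : d <= e * N z / 2 by rewrite /d ge_min lexx orbT.
have F : Filter (nbhs (0 : C)) by apply _.
have shc0 : (fun h : C => h + z) @ (0 : C) --> (0 + z : C).
  have H1 : (id : C -> C) @ (0 : C) --> (0 : C) by exact: cvg_id.
  have H2 : (cst z : C -> C) @ (0 : C) --> z.
    apply: cvg_cst.
  exact: (cvgD H1 H2).
have shc : (fun h : C => h + z) @ (0 : C) --> z by have := shc0; rewrite (add0r z).
have kc : (fun h : C => clog (h + z) - clog z) @ (0 : C) --> (0 : C).
  have H1 : (fun h : C => clog (h + z)) @ (0 : C) --> clog z.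
    exact: (cvg_comp _ _ shc (continuous_clog z0)).
  have H2 : (cst (clog z) : C -> C) @ (0 : C) --> clog z.
    apply: cvg_cst.
  have H3 := cvgB H1 H2.
  rewrite (subrr (clog z)) in H3; exact: H3.
have pos : \forall h \near (0 : C), 0 < Re (h + z).
  have P : \forall w \near z, 0 < Re w.
    have H : \forall r \near Re z, 0 < r by exact: lt_nbhsr.
    exact: (@continuous_Re R z _ H).
  exact: (shc _ P).
have K : \forall h \near (0 : C), let k := clog (h + z) - clog z in
    `|cexp k - 1 - k| <= embC d * `|k|.
  exact: (kc _ (cexp_littleo d0)).
near=> h.
have hp : 0 < Re (h + z) by near: h.
set k := clog (h + z) - clog z.
have Ek : cexp k = 1 + h / z.
  apply: (mulIf (cexp_neq0 (clog z))); rewrite -cexpD subrK !clogK //.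
  by rewrite mulrDl mul1r divfK // addrC.
have : `|cexp k - 1 - k| <= embC d * `|k| by rewrite /k; near: h.
clearbody k.
have -> : cexp k - 1 - k = - (k - z^-1 * h).
  by rewrite Ek opprB [1 + _]addrC addrK [h / z]mulrC.
rewrite normrN; set u := k - _ => Hu.
have : `|k| <= `|u| + `|z^-1 * h| by rewrite (le_trans _ (ler_normD u (z^-1 * h))) // [u + _]subrK.
have Nhz : `|z^-1 * h| = embC (N h / N z).
  by rewrite normrM normfV !NE /embC -fmorphV -rmorphM mulrC.
move: Hu; rewrite Nhz !NE /embC -?rmorphM -?rmorphD !lecR => Hu Hk.
(* [N k <= d N k + N h / N z] with [d <= 1/2] bounds [N k] by [2 N h / N z]. *)
have N2 : N u <= 2 * d * (N h / N z).
  have := Nge u; have := Nge k; nra.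
apply: (le_trans N2).
rewrite [leRHS](_ : _ = (e * N z) * (N h / N z)); last by field; rewrite gt_eqF.
by rewrite ler_wpM2r ?divr_ge0 // ?(ltW Nz) //; lra.
Unshelve. all: by end_near. Qed.

Lemma embC_dnbhs : embC @ (0 : R)^' --> (0 : C)^'.
Proof.
move=> P /= [e e0 He].
have /posC_emb[r r0 Er] := e0.
exists r => //= x xr x0; apply: He => /=; last first.
  by apply/eqP => -[] /eqP; rewrite (negbTE x0).
by move: xr; rewrite /= !sub0r !normrN Er normc_def /= expr0n addr0 sqrtr_sqr ltcR.
Qed.

(** A function on a real ray whose complex derivative vanishes is constant: the
    mean value theorem applies to its real and imaginary parts. *)
Lemma ray_constant (G : C -> C) :
  (forall t : R, 0 < t -> is_diff (embC t) G (cst 0)) ->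
  forall t : R, 0 < t -> G (embC t) = G 1.
Proof.
move=> dG t t0.
have emb0 := embC_dnbhs.
(* [P] is the real or the imaginary part; the ray is parametrized by the real
   exponential so that the derivative vanishes on the whole line. *)
have dP (P : C -> R) (P0 : P 0 = 0) (Pc : continuous P)
    (PZ : forall (a : R) (z : C), P (embC a * z) = a * P z)
    (PB : forall z w : C, P (z - w) = P z - P w) :
    forall s t : R, P (G (embC (expR s))) = P (G (embC (expR t))).
  pose f := fun x : R => P (G (embC x)).
  have df (x : R) : 0 < x -> is_derive x (1 : R) f (0 : R).
    move=> x0; have [gx gE] := dG x x0.
    have E : 'D_1 G (embC x) = 0 by rewrite deriveE // gE.
    have dx : derivable G (embC x) 1 by apply/derivable1_diffP.
    have H0 : (fun h : C => h^-1 *: ((G \o shift (embC x)) (h *: 1) - G (embC x))) @ (0 : C)^' --> ('D_1 G (embC x) : C).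
      exact: dx.
    rewrite E in H0.
    have H1 := cvg_comp _ _ (cvg_comp _ _ emb0 H0) (Pc 0).
    rewrite P0 in H1.
    have H2 : (fun h : R => h^-1 *: ((f \o shift x) (h *: (1 : R)) - f x)) @ (0 : R)^' --> (0 : R).
      apply: cvg_trans H1; apply: near_eq_cvg; near=> h => /=.
      rewrite /f -PB.
      have -> : (embC h)^-1 = embC h^-1 by rewrite /embC fmorphV.
      rewrite -[_ *: (_ - _)]/(_ * _) PZ; congr (_ * (P (G _ - _))).
      by rewrite /embC rmorphD rmorphM rmorph1.
    apply: DeriveDef; first by apply/cvg_ex; exists 0; exact: H2.
    exact: (cvg_lim _ H2).
  move=> s u; apply: (@is_derive_0_is_cst R (fun s => f (expR s))) => y.
  have := @is_derive1_comp _ f expR y _ _ (df _ (expR_gt0 y)) (is_derive_expR y).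
  by rewrite ?(mulr0, mul0r, scale0r).
have := dP _ erefl (@continuous_Re R) _ _ (ln t) 0.
have := dP _ erefl (@continuous_Im R) _ _ (ln t) 0.
rewrite lnK ?posrE // expR0 => EI ER.
apply/eqP; rewrite eq_complex; apply/andP; split; apply/eqP.
  by apply: ER => [a [x y]|[x y] [a b]] //=; rewrite mul0r subr0.
by apply: EI => [a [x y]|[x y] [a b]] //=; rewrite mul0r addr0.
Unshelve. all: by end_near. Qed.

(** Euler's relation makes [t^-1 B(t u)] constant on the ray [t > 0]; its limit
    at 0 is [B'(0) u]. *)
Lemma homogeneous_linear (B : C -> C) :
  (forall u, differentiable B u) -> (forall u, 'd B u u = B u) ->
  forall u, B u = u * B 1.
Proof.
move=> dB HB.
have hom u t : 0 < t -> (embC t)^-1 * B (embC t * u) = B u.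
  move=> t0; pose G (s : C) : C := s^-1 * B (s * u).
  have -> : B u = G 1 by rewrite /G invr1 !mul1r.
  apply: (@ray_constant G) => // s s0.
  have sn : embC s != 0 by apply/eqP => -[] /eqP; rewrite gt_eqF.
  have D1 : is_diff (embC s) (fun y : C => y * u) (fun v : C => v * u).
    exact: (is_diff_scalel (embC s) u).
  have D2 : is_diff (embC s) (fun y : C => B (y * u)) (fun v : C => 'd B (embC s * u) (v * u)).
    exact: (is_diff_comp D1 (is_diffP (dB _))).
  have D3 := is_diff_inv (is_diff_id (embC s)) sn.
  have := is_diff_mul D3 D2; congr (is_diff _ _ _); apply/funext => v.
  have -> : v * u = (v / embC s) *: (embC s * u) by rewrite /GRing.scale /= mulrA divfK.
  rewrite linearZ /= HB /GRing.scale /=; field.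
  exact: sn.
have hom0 u : B u = 'd B 0 u.
  have B0 : B 0 = 0 by rewrite -HB linear0.
  have D : 'D_u B 0 = 'd B 0 u by rewrite deriveE.
  have H0 : (fun h : C => h^-1 *: ((B \o shift 0) (h *: u) - B 0)) @ (0 : C)^' --> ('D_u B 0 : C).
    have dd : derivable B 0 u by exact: diff_derivable.
    exact: dd.
  rewrite D in H0.
  have right : embC @ (0 : R)^'+ --> (0 : C)^'.
    move=> P HP; have H := embC_dnbhs HP.
    have {}H : \forall x \near (0 : R), x != 0 -> P (embC x) by exact: H.
    have : \forall x \near (0 : R), 0 < x -> P (embC x).
      by apply: filterS H => x Hx x0; apply: Hx; rewrite gt_eqF.
    exact.
  have H1 := cvg_comp _ _ right H0.
  have H2 : (cst (B u) : R -> C) @ (0 : R)^'+ --> ('d B 0 u : C).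
    apply: cvg_trans H1; apply: near_eq_cvg; near=> t => /=.
    by rewrite addr0 B0 subr0; apply: hom.
  have H3 : (cst (B u) : R -> C) @ (0 : R)^'+ --> (B u : C).
    apply: cvg_cst.
  exact: (cvg_unique (@norm_hausdorff _ _) H3 H2).
move=> u; rewrite hom0 (hom0 1) -{1}[u]mulr1.
by rewrite -[u * 1]/(u *: 1) linearZ.
Unshelve. all: by end_near. Qed.

End ComplexDerivative.

(** * Charts and tangent vectors *)

Section Charts.
Variables (R : realType) (M : topologicalType) (n : nat) (A : atlas R M n).
Hypothesis hM : complex_manifold A.

Lemma near_crd_inv i p (P : set M) : dom A i p -> nbhs p P ->
  \forall z \near crd A i p, P (crd_inv A i z).
Proof.
move=> ip Pp; have H := cm_inv_cont hM ip.
have Pp' : nbhs (crd_inv A i (crd A i p)) P by rewrite (cm_inv hM ip).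
exact: (H _ Pp').
Qed.

Lemma near_dom i p : dom A i p -> \forall z \near crd A i p, dom A i (crd_inv A i z).
Proof.
move=> ip; apply: near_crd_inv => //.
by apply: open_nbhs_nbhs; split => //; exact: (cm_open_dom hM).
Qed.

Lemma near_crdK i p : dom A i p -> \forall z \near crd A i p, crd A i (crd_inv A i z) = z.
Proof.
move=> ip.
have : nbhs (crd A i p) (crd A i @` dom A i).
  by apply: open_nbhs_nbhs; split; [exact: (cm_open_im hM) | exists p].
by apply: filterS => _ [q iq <-]; rewrite (cm_inv hM iq).
Qed.

Lemma change_chartE i j k p v : dom A i p -> dom A j p -> dom A k p ->
  'd (crd A k \o crd_inv A i) (crd A i p) v =
  'd (crd A k \o crd_inv A j) (crd A j p) ('d (crd A j \o crd_inv A i) (crd A i p) v).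
Proof.
move=> ip jp kp.
have Ep : (crd A j \o crd_inv A i) (crd A i p) = crd A j p by rewrite /= (cm_inv hM ip).
have D := is_diff_compE Ep (is_diffP (cm_compat hM ip jp)) (is_diffP (cm_compat hM jp kp)).
have jN : nbhs p (dom A j) by apply: open_nbhs_nbhs; split => //; exact: (cm_open_dom hM).
have E : \forall z \near crd A i p, (crd A k \o crd_inv A j) ((crd A j \o crd_inv A i) z) =
    (crd A k \o crd_inv A i) z.
  by apply: filterS (near_crd_inv ip jN) => z jz /=; rewrite (cm_inv hM jz).
exact: (is_diffE _ (near_eq_is_diff E D)).
Qed.

Lemma change_chart_id i p v : dom A i p ->
  'd (crd A i \o crd_inv A i) (crd A i p) v = v.
Proof.
move=> ip.
have E : \forall z \near crd A i p, id z = (crd A i \o crd_inv A i) z.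
  by apply: filterS (near_crdK ip) => z /= ->.
exact: (is_diffE _ (near_eq_is_diff E (is_diff_id _))).
Qed.

(** A coordinate vector in one chart determines a tangent vector, its other
    coordinates being given by the chain rule. *)
Lemma tangent_extend i p v : dom A i p -> exists2 w, tangent A p w & w i = v.
Proof.
move=> ip; exists (fun j => if `[< dom A j p >] then
    'd (crd A j \o crd_inv A i) (crd A i p) v else 0).
  split=> [j njp|j k jp kp]; first by case: asboolP.
  by rewrite !asboolT //; exact: change_chartE.
by rewrite asboolT // change_chart_id.
Qed.

Lemma bracketE (X Y : field_family A) i p : dom A i p ->
  bracket X Y p i = 'd (vf_comp Y i) (crd A i p) (X p i) - 'd (vf_comp X i) (crd A i p) (Y p i).
Proof. by move=> ip; rewrite /bracket asboolT. Qed.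

Lemma tangent_inj i p v w : dom A i p -> tangent A p v -> tangent A p w ->
  v i = w i -> v = w.
Proof.
move=> ip [v0 vE] [w0 wE] vw; apply/funext => j.
have [jp|njp] := pselect (dom A j p); last by rewrite v0 // w0.
by rewrite (vE i j) // (wE i j) // vw.
Qed.

End Charts.

(** * The vertical component of a lift *)

Section Bundle.
Variables (R : realType) (M : topologicalType) (n : nat) (A : atlas R M n).
Hypothesis hM : complex_manifold A.
Variable L : line_bundle A.
Local Notation C := (Cplx R).
Local Notation T := (total_atlas A L).
Let hL := lb_axioms L.

(** The fiber coordinate is the last one. *)
Definition vert (z : 'rV[C]_(n + 1)) : C := z 0 (rshift n 0).

Lemma vert_row_mx (z : 'rV[C]_n) (u : C) : vert (row_mx z (const_mx u)) = u.
Proof. by rewrite /vert row_mxEr mxE. Qed.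

Lemma row_mx_vert (z : 'rV[C]_(n + 1)) : row_mx (lsubmx z) (const_mx (vert z)) = z.
Proof.
rewrite -[RHS]hsubmxK; congr row_mx; apply/rowP => k.
by rewrite !mxE /vert ord1.
Qed.

Lemma is_diff_vert (V : normedModType C) (f df : V -> 'rV[C]_(n + 1)) x :
  is_diff x f df -> is_diff x (fun y => vert (f y) : C) (fun v => vert (df v) : C).
Proof. exact: is_diff_coord. Qed.

Lemma near_lsubmx (x : 'rV[C]_(n + 1)) (P : set 'rV[C]_n) : nbhs (lsubmx x) P ->
  \forall z \near x, P (lsubmx z).
Proof.
move=> HP; exact: (differentiable_continuous (is_diff_ex (is_diff_lsubmx x)) HP).
Qed.

Lemma total_crd_invE i (j : tidx L) z u :
  crd_inv T (i, j) (row_mx z (const_mx u)) = tinv j (crd_inv A i z) u.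
Proof. by rewrite /= row_mxKl row_mxKr mxE. Qed.

Lemma total_crdE i (j : tidx L) p u : triv j p ->
  crd T (i, j) (tinv j p u) = row_mx (crd A i p) (const_mx u).
Proof. by move=> jp; rewrite /= (lb_proj hL) // (lb_fib hL). Qed.

Lemma near_total i (j : tidx L) p u (P : set M) : dom A i p -> triv j p -> nbhs p P ->
  \forall z \near row_mx (crd A i p) (@const_mx _ 1 1 u),
    P (crd_inv A i (lsubmx z)).
Proof.
move=> ip jp Pp.
apply: (near_lsubmx (P := fun w => P (crd_inv A i w))).
by rewrite row_mxKl; exact: near_crd_inv.
Qed.

Lemma nbhs_triv (j : tidx L) p : triv j p -> nbhs p (triv j).
Proof. by move=> jp; apply: open_nbhs_nbhs; split => //; exact: (lb_open hL). Qed.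

Lemma nbhs_dom i p : dom A i p -> nbhs p (dom A i).
Proof. by move=> ip; apply: open_nbhs_nbhs; split => //; exact: (cm_open_dom hM). Qed.

Lemma is_diff_row (V : normedModType C) (f df : V -> 'rV[C]_n) (g dg : V -> C) x :
  is_diff x f df -> is_diff x g dg ->
  is_diff x (fun y => row_mx (f y) (const_mx (g y)) : 'rV[C]_(n + 1))
    (fun v => row_mx (df v) (const_mx (dg v))).
Proof. by move=> Hf Hg; exact: (is_diff_row_mx Hf (is_diff_const_mx 1 Hg)). Qed.

Lemma diff_bproj i (j : tidx L) e v : dom T (i, j) e ->
  'd (crd A i \o @bproj R M L \o crd_inv T (i, j)) (crd T (i, j) e) v = lsubmx v.
Proof.
move=> [/= ip jp].
have E : \forall z \near crd T (i, j) e,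
    lsubmx z = (crd A i \o @bproj R M L \o crd_inv T (i, j)) z.
  have N1 := near_total (fib j e) ip jp (nbhs_triv jp).
  have N2 : \forall z \near crd T (i, j) e, crd A i (crd_inv A i (lsubmx z)) = lsubmx z.
    apply: (near_lsubmx (P := fun w => crd A i (crd_inv A i w) = w)).
    by rewrite row_mxKl; exact: near_crdK.
  near=> z => /=.
  have z1 : triv j (crd_inv A i (lsubmx z)) by near: z.
  have z2 : crd A i (crd_inv A i (lsubmx z)) = lsubmx z by near: z.
  by rewrite (lb_proj hL _ z1) z2.
exact: (is_diffE _ (near_eq_is_diff E (is_diff_lsubmx _))).
Unshelve. all: by end_near. Qed.

(** What belonging to a lift means for a single field over [X]. *)
Definition lifts (Xh : field_family T) (X : field_family A) : Prop :=
  [/\ vector_field T Xh, related (@bproj R M L) Xh X & bracket Xh (euler A L) = vf_zero T].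

(** The coefficient of [u d/du], read off at the point [u = 1] of the fiber. *)
Definition beta (Xh : field_family T) i (j : tidx L) (p : M) : C :=
  vert (Xh (tinv j p 1) (i, j)).

Lemma vf_comp_is_diff Xh X i (j : tidx L) p u : lifts Xh X -> dom A i p -> triv j p ->
  is_diff (row_mx (crd A i p) (const_mx u)) (vf_comp Xh (i, j))
    ('d (vf_comp Xh (i, j)) (row_mx (crd A i p) (const_mx u))).
Proof.
move=> [[_ dX] _ _] ip jp; apply: is_diffP.
have := dX (i, j) (tinv j p u); rewrite total_crdE //; apply.
by rewrite /= (lb_proj hL _ jp).
Qed.

Lemma vf_compE (Xh : field_family T) i (j : tidx L) z u :
  vf_comp Xh (i, j) (row_mx z (const_mx u)) = Xh (tinv j (crd_inv A i z) u) (i, j).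
Proof. by rewrite /vf_comp total_crd_invE. Qed.

Lemma eulerE i (j : tidx L) e : dom T (i, j) e ->
  euler A L e (i, j) = row_mx 0 (const_mx (fib j e)).
Proof. by move=> De; rewrite /euler asboolT. Qed.

Lemma diff_euler i (j : tidx L) e v : dom T (i, j) e ->
  'd (vf_comp (euler A L) (i, j)) (crd T (i, j) e) v = row_mx 0 (const_mx (vert v)).
Proof.
move=> [/= ip jp].
pose f (z : 'rV[C]_(n + 1)) := row_mx (0 : 'rV[C]_n) (const_mx (vert z) : 'rV[C]_1).
have Df : is_diff (crd T (i, j) e) f f.
  exact: (is_diff_row (is_diff_cst _ _) (is_diff_vert (is_diff_id _))).
have E : \forall z \near crd T (i, j) e, f z = vf_comp (euler A L) (i, j) z.
  have N1 := near_total (fib j e) ip jp (nbhs_triv jp).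
  have N2 := near_total (fib j e) ip jp (nbhs_dom ip).
  near=> z.
  have z1 : triv j (crd_inv A i (lsubmx z)) by near: z.
  have z2 : dom A i (crd_inv A i (lsubmx z)) by near: z.
  rewrite -[z in RHS]row_mx_vert vf_compE /euler asboolT /=; last first.
    by rewrite (lb_proj hL _ z1).
  by rewrite (lb_fib hL _ z1).
exact: (is_diffE _ (near_eq_is_diff E Df)).
Unshelve. all: by end_near. Qed.

Lemma lsubmx_lift Xh X i (j : tidx L) e : lifts Xh X -> dom T (i, j) e ->
  lsubmx (Xh e (i, j)) = X (bproj e) i.
Proof.
move=> [_ rX _] De; have [/= ip jp] := De.
by rewrite (rX e (i, j) i De ip) diff_bproj.
Qed.

(** Commutation with the Euler field is Euler's relation for the vertical component
    along a fiber, which is therefore linear in the fiber coordinate. *)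
Lemma lift_form Xh X i (j : tidx L) e : lifts Xh X -> dom T (i, j) e ->
  Xh e (i, j) = row_mx (X (bproj e) i) (const_mx (fib j e * beta Xh i j (bproj e))).
Proof.
move=> lX De; have [/= ip jp] := De; set p := bproj e in ip jp *.
rewrite -[LHS]row_mx_vert (lsubmx_lift lX De); congr (row_mx _ (const_mx _)).
pose B (u : C) : C := vert (Xh (tinv j p u) (i, j)).
have BE u : B u = vert (vf_comp Xh (i, j) (row_mx (crd A i p) (const_mx u))).
  by rewrite vf_compE (cm_inv hM ip).
have dB u : is_diff u B (fun w : C =>
    vert ('d (vf_comp Xh (i, j)) (row_mx (crd A i p) (const_mx u)) (row_mx 0 (const_mx w)))).
  rewrite (funext BE : B = _); apply: is_diff_vert.
  apply: is_diff_compE (vf_comp_is_diff u lX ip jp) => //.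
  exact: (is_diff_row (is_diff_cst _ _) (is_diff_id _)).
have Euler u : 'd B u u = B u.
  rewrite (is_diffE _ (dB u)).
  have Du : dom T (i, j) (tinv j p u) by rewrite /= (lb_proj hL _ jp).
  have [_ _ br] := lX.
  have br0 : bracket Xh (euler A L) (tinv j p u) (i, j) = 0 by rewrite br.
  have crdE := total_crdE i u jp.
  have eulE : euler A L (tinv j p u) (i, j) = row_mx 0 (const_mx u).
    by rewrite (eulerE Du) (lb_fib hL _ jp).
  have br1 : row_mx 0 (const_mx (B u)) -
      'd (vf_comp Xh (i, j)) (row_mx (crd A i p) (const_mx u)) (row_mx 0 (const_mx u)) = 0.
    apply: etrans br0; rewrite (bracketE _ _ Du); congr (_ - _).
      exact: (esym (diff_euler _ Du)).
    by rewrite crdE eulE.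
  move/subr0_eq: br1 => <-; exact: vert_row_mx.
have := homogeneous_linear (fun u => is_diff_ex (dB u)) Euler (fib j e).
by rewrite /B (lb_tinv hL jp).
Qed.

End Bundle.

Section VerticalPart.
Variables (R : realType) (M : topologicalType) (n : nat) (A : atlas R M n).
Hypothesis hM : complex_manifold A.
Variable L : line_bundle A.
Local Notation C := (Cplx R).
Local Notation T := (total_atlas A L).
Let hL := lb_axioms L.

Lemma beta_differentiable (Xh : field_family T) X i (j : tidx L) p :
  lifts Xh X -> dom A i p -> triv j p ->
  differentiable (fun z => beta Xh i j (crd_inv A i z) : C) (crd A i p).
Proof.
move=> lX ip jp.
have D1 : is_diff (crd A i p) (fun z : 'rV[C]_n => row_mx z (const_mx (1 : C)) : 'rV[C]_(n + 1))
    (fun v => row_mx v (const_mx (0 : C))).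
  exact: (is_diff_row (is_diff_id _) (is_diff_cst (1 : C) _)).
have D2 := is_diff_vert (is_diff_compE erefl D1 (vf_comp_is_diff 1 lX ip jp)).
apply: (near_eq_diff _ (is_diff_ex D2)).
by near=> z; rewrite vf_compE.
Unshelve. all: by end_near. Qed.

(** The vertical component is [u beta(z)]; at [u = 1] its differential is given
    by the product rule. *)
Lemma diff_vf_comp (Xh : field_family T) X i (j : tidx L) p (a : 'rV[C]_n) (b : C) :
  lifts Xh X -> dom A i p -> triv j p ->
  vert ('d (vf_comp Xh (i, j)) (row_mx (crd A i p) (const_mx 1)) (row_mx a (const_mx b))) =
  b * beta Xh i j p + 'd (fun z => beta Xh i j (crd_inv A i z) : C) (crd A i p) a.
Proof.
move=> lX ip jp; set x := row_mx _ _.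
have D0 := is_diff_vert (vf_comp_is_diff 1 lX ip jp).
have lx : lsubmx x = crd A i p by rewrite /x row_mxKl.
have D1 : is_diff x (fun z : 'rV[C]_(n + 1) => vert z : C) (fun v => vert v : C).
  exact: (is_diff_vert (is_diff_id _)).
have D2 := is_diff_compE lx (is_diff_lsubmx x) (is_diffP (beta_differentiable lX ip jp)).
have D3 := is_diff_mul D1 D2.
have E : \forall z \near x, vert z * beta Xh i j (crd_inv A i (lsubmx z)) =
    vert (vf_comp Xh (i, j) z) :> C.
  have N1 := near_total hM 1 ip jp (nbhs_triv jp).
  have N2 := near_total hM 1 ip jp (nbhs_dom hM ip).
  near=> z.
  have z1 : triv j (crd_inv A i (lsubmx z)) by near: z.
  have z2 : dom A i (crd_inv A i (lsubmx z)) by near: z.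
  rewrite -[z in RHS]row_mx_vert vf_compE.
  have De : dom T (i, j) (tinv j (crd_inv A i (lsubmx z)) (vert z)).
    by rewrite /= (lb_proj hL _ z1).
  by rewrite (lift_form hM lX De) vert_row_mx (lb_fib hL _ z1) (lb_proj hL _ z1).
rewrite -(is_diffE _ D0) (is_diffE _ (near_eq_is_diff E D3)) /=.
by rewrite !vert_row_mx row_mxKl lx (cm_inv hM ip) mul1r addrC mulrC.
Unshelve. all: by end_near. Qed.

(** The vertical components [u beta] of two lifts bracket as the semidirect product
    of vector fields and functions: the products [beta_X beta_Y] cancel. *)
Lemma beta_bracket (Xh Yh : field_family T) X Y i (j : tidx L) p :
  lifts Xh X -> lifts Yh Y -> dom A i p -> triv j p ->
  beta (bracket Xh Yh) i j p =
  'd (fun z => beta Yh i j (crd_inv A i z) : C) (crd A i p) (X p i) -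
  'd (fun z => beta Xh i j (crd_inv A i z) : C) (crd A i p) (Y p i).
Proof.
move=> lX lY ip jp; set e := tinv j p 1.
have pe : bproj e = p by rewrite (lb_proj hL _ jp).
have De : dom T (i, j) e by rewrite /= pe.
have crdE := total_crdE i 1 jp.
have form Zh Z : lifts Zh Z -> Zh e (i, j) = row_mx (Z p i) (const_mx (beta Zh i j p)).
  by move=> lZ; rewrite (lift_form hM lZ De) pe (lb_fib hL _ jp) mul1r.
rewrite {1}/beta (bracketE _ _ De) -/e.
have vertB (u v : 'rV[C]_(n + 1)) : vert (u - v) = vert u - vert v by rewrite /vert !mxE.
rewrite vertB crdE (form _ _ lX) (form _ _ lY).
rewrite (diff_vf_comp _ _ lY ip jp) (diff_vf_comp _ _ lX ip jp).
by rewrite opprD addrACA [X in X - _]mulrC subrr add0r.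
Qed.

End VerticalPart.

(** * Bundle maps in coordinates *)

Section BundleMap.
Variables (R : realType) (M : topologicalType) (n : nat) (A : atlas R M n).
Hypothesis hM : complex_manifold A.
Variables (L1 L2 : line_bundle A) (F : tot L1 -> tot L2).
Hypothesis hF : bundle_map F.
Local Notation C := (Cplx R).
Local Notation T1 := (total_atlas A L1).
Local Notation T2 := (total_atlas A L2).
Let hL1 := lb_axioms L1.

(** The matrix of [F] on the fiber over [p].  With [F] the identity these are
    the transition functions of the bundle. *)
Definition trans (j : tidx L1) (k : tidx L2) (p : M) : C := fib k (F (tinv j p 1)).

Lemma transE (j : tidx L1) (k : tidx L2) e : triv j (bproj e) -> triv k (bproj e) ->
  fib k (F e) = trans j k (bproj e) * fib j e.
Proof.
move=> jp kp; have [_ _ /(_ j k _ jp kp)[c cE]] := hF.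
by rewrite (cE e) // /trans cE ?(lb_proj hL1) // (lb_fib hL1) // mulr1.
Qed.

Lemma bproj_F e : bproj (F e) = bproj e.
Proof. by have [_ ->] := hF. Qed.

Lemma trans_differentiable i (j : tidx L1) (k : tidx L2) p :
  dom A i p -> triv j p -> triv k p ->
  differentiable (fun z => trans j k (crd_inv A i z) : C) (crd A i p).
Proof.
move=> ip jp kp; have [[_ dF] _ _] := hF.
have D1 : is_diff (crd A i p) (fun z : 'rV[C]_n => row_mx z (const_mx (1 : C)) : 'rV[C]_(n + 1))
    (fun v => row_mx v (const_mx (0 : C))).
  exact: (is_diff_row (is_diff_id _) (is_diff_cst (1 : C) _)).
have De : dom T1 (i, j) (tinv j p 1) by rewrite /= (lb_proj hL1 _ jp).
have DFe : dom T2 (i, k) (F (tinv j p 1)) by rewrite /= bproj_F (lb_proj hL1 _ jp).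
have D2 := dF _ _ _ De DFe; rewrite (total_crdE i 1 jp) in D2.
have D3 := is_diff_vert (is_diff_compE erefl D1 (is_diffP D2)).
apply: (near_eq_diff _ (is_diff_ex D3)).
near=> z; have := total_crd_invE i j z 1; rewrite /comp => ->.
by rewrite /= vert_row_mx.
Unshelve. all: by end_near. Qed.

(** In coordinates the map is [(z, u) |-> (z', c(z) u)], with [z'] the change of
    chart of the base. *)
Lemma diff_bundle_map i i' (j : tidx L1) (k : tidx L2) e v w :
  dom T1 (i, j) e -> dom A i' (bproj e) -> triv k (bproj e) ->
  'd (crd T2 (i', k) \o F \o crd_inv T1 (i, j)) (crd T1 (i, j) e) (row_mx v (const_mx w)) =
  row_mx ('d (crd A i' \o crd_inv A i) (crd A i (bproj e)) v)
    (const_mx (fib j e * 'd (fun z => trans j k (crd_inv A i z) : C) (crd A i (bproj e)) v +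
      trans j k (bproj e) * w)).
Proof.
move=> [/= ip jp] i'p kp; set p := bproj e in ip jp i'p kp *.
pose x : 'rV[C]_(n + 1) := row_mx (crd A i p) (const_mx (fib j e)).
rewrite -[X in 'd _ X]/x.
have lx : lsubmx x = crd A i p by rewrite /x row_mxKl.
have D1 : is_diff x (fun z : 'rV[C]_(n + 1) => vert z : C) (fun v => vert v : C).
  exact: (is_diff_vert (is_diff_id _)).
have D2 := is_diff_compE lx (is_diff_lsubmx x) (is_diffP (trans_differentiable ip jp kp)).
have D3 := is_diff_compE lx (is_diff_lsubmx x) (is_diffP (cm_compat hM ip i'p)).
have D4 := is_diff_row D3 (is_diff_mul D1 D2).
have E : \forall z \near x,
   row_mx ((crd A i' \o crd_inv A i) (lsubmx z))
     (const_mx (vert z * trans j k (crd_inv A i (lsubmx z)))) =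
   (crd T2 (i', k) \o F \o crd_inv T1 (i, j)) z.
  have N1 := near_total hM (fib j e) ip jp (nbhs_triv jp).
  have N2 := near_total hM (fib j e) ip jp (nbhs_triv kp).
  near=> z.
  have z1 : triv j (crd_inv A i (lsubmx z)) by near: z.
  have z2 : triv k (crd_inv A i (lsubmx z)) by near: z.
  rewrite -[z in RHS]row_mx_vert /comp total_crd_invE.
  set e' := tinv j _ _; have pe' : bproj e' = crd_inv A i (lsubmx z).
    by rewrite /e' (lb_proj hL1 _ z1).
  have FE : fib k (F e') = trans j k (crd_inv A i (lsubmx z)) * vert z.
    have := @transE j k e'; rewrite pe' => -> //.
    by rewrite /e' (lb_fib hL1 _ z1).
  by rewrite /= bproj_F pe' FE mulrC.
rewrite (is_diffE _ (near_eq_is_diff E D4)) /=.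
by rewrite !vert_row_mx row_mxKl lx (cm_inv hM ip).
Unshelve. all: by end_near. Qed.

End BundleMap.

Section BundleIso.
Variables (R : realType) (M : topologicalType) (n : nat) (A : atlas R M n).
Hypothesis hM : complex_manifold A.
Local Notation C := (Cplx R).

Lemma trans_neq0 (L1 L2 : line_bundle A) (F : tot L1 -> tot L2) j k p :
  bundle_iso F -> triv j p -> triv k p -> trans F j k p != 0.
Proof.
move=> [hF [G [hG FK _]]] jp kp; set e := tinv j p 1.
have pe : bproj e = p by rewrite /e (lb_proj (lb_axioms L1) _ jp).
have H1 := @transE _ _ _ _ _ _ _ hF j k e.
have H2 := @transE _ _ _ _ _ _ _ hG k j (F e).
rewrite (bproj_F hF) pe in H1 H2; rewrite FK (H1 jp kp) in H2.
have fe : fib j e = 1 by rewrite /e (lb_fib (lb_axioms L1) _ jp).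
apply/eqP => c0; move: (H2 kp jp); rewrite c0 fe mul0r mulr0 => /eqP.
by rewrite oner_eq0.
Qed.

(** Transformation of the tangent vectors [Xh e] under the transition
    [u |-> c(z) u], at a point where [u = 1]. *)
Lemma beta_change (L : line_bundle A) (Xh : field_family (total_atlas A L)) X i i' j k p :
  lifts Xh X -> dom A i p -> dom A i' p -> triv j p -> triv k p ->
  trans (@id (tot L)) j k p * beta Xh i' k p =
  'd (fun z => trans (@id (tot L)) j k (crd_inv A i z) : C) (crd A i p) (X p i) +
  trans (@id (tot L)) j k p * beta Xh i j p.
Proof.
move=> lX ip i'p jp kp; set e := tinv j p 1; have hL := lb_axioms L.
have pe : bproj e = p by rewrite /e (lb_proj hL _ jp).
have fe : fib j e = 1 by rewrite /e (lb_fib hL _ jp).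
have De : dom (total_atlas A L) (i, j) e by rewrite /= pe.
have De' : dom (total_atlas A L) (i', k) e by rewrite /= pe.
have [[tX _] _ _] := lX.
have tE : Xh e (i', k) = 'd (crd (total_atlas A L) (i', k) \o id \o
    crd_inv (total_atlas A L) (i, j)) (crd (total_atlas A L) (i, j) e) (Xh e (i, j)).
  exact: (tX e).2 (i, j) (i', k) De De'.
have i'e : dom A i' (bproj e) by rewrite pe.
have ke : triv k (bproj e) by rewrite pe.
have DE := diff_bundle_map hM (proj1 (bundle_iso_id L)) (X (bproj e) i)
  (fib j e * beta Xh i j (bproj e)) De i'e ke.
rewrite (lift_form hM lX De) in tE; move: (etrans tE DE).
rewrite (lift_form hM lX De').
move=> /(congr1 (@vert R n)); rewrite !vert_row_mx pe fe !mul1r => <-.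
by [].
Qed.

Lemma trans_id1 (L : line_bundle A) j p : triv j p -> trans (@id (tot L)) j j p = 1.
Proof. by move=> jp; rewrite /trans (lb_fib (lb_axioms L) _ jp). Qed.

Lemma beta_chart (L : line_bundle A) (Xh : field_family (total_atlas A L)) X i i' j p :
  lifts Xh X -> dom A i p -> dom A i' p -> triv j p ->
  beta Xh i' j p = beta Xh i j p.
Proof.
move=> lX ip i'p jp; have := beta_change lX ip i'p jp jp.
rewrite trans_id1 // !mul1r => ->.
have E : \forall z \near crd A i p, (1 : C) = trans (@id (tot L)) j j (crd_inv A i z).
  apply: filterS (near_crd_inv hM ip (nbhs_triv jp)) => z jz.
  by rewrite trans_id1.
by rewrite (is_diffE _ (near_eq_is_diff E (is_diff_cst (1 : C) _))) add0r.
Qed.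

(** Both the defect and [dc/c] change by the difference of the logarithmic
    derivatives of the two transition functions.  The invariant is the vertical
    component of the second lift minus the image of the first under [F]. *)
Lemma defect_invariant (L1 L2 : line_bundle A) (F : tot L1 -> tot L2)
    (Xh1 : field_family (total_atlas A L1)) (Xh2 : field_family (total_atlas A L2)) X i j k j' k' p :
  bundle_iso F -> lifts Xh1 X -> lifts Xh2 X -> dom A i p ->
  triv j p -> triv k p -> triv j' p -> triv k' p ->
  beta Xh2 i k' p - beta Xh1 i j' p -
    (trans F j' k' p)^-1 * 'd (fun z => trans F j' k' (crd_inv A i z) : C) (crd A i p) (X p i) =
  beta Xh2 i k p - beta Xh1 i j p -
    (trans F j k p)^-1 * 'd (fun z => trans F j k (crd_inv A i z) : C) (crd A i p) (X p i).
Proof.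
move=> isoF l1 l2 ip jp kp j'p k'p; have [hF _] := isoF.
pose g1 := trans (@id (tot L1)) j j'; pose g2 := trans (@id (tot L2)) k k'.
pose c := trans F j k; pose c' := trans F j' k'.
have cocycle q : triv j q -> triv k q -> triv j' q -> triv k' q -> c' q * g1 q = g2 q * c q.
  move=> jq kq j'q k'q; set e := tinv j q 1.
  have pe : bproj e = q by rewrite /e (lb_proj (lb_axioms L1) _ jq).
  have H1 := @transE _ _ _ _ _ _ _ hF j' k' e.
  have H2 := @transE _ _ _ _ _ _ _ (proj1 (bundle_iso_id L2)) k k' (F e).
  rewrite (bproj_F hF) pe in H2; rewrite pe in H1.
  by rewrite -(H1 j'q k'q) -(H2 kq k'q).
have D1 := is_diffP (trans_differentiable hF ip jp kp).
have D2 := is_diffP (trans_differentiable hF ip j'p k'p).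
have D3 := is_diffP (trans_differentiable (proj1 (bundle_iso_id L1)) ip jp j'p).
have D4 := is_diffP (trans_differentiable (proj1 (bundle_iso_id L2)) ip kp k'p).
have E : \forall z \near crd A i p,
    trans F j' k' (crd_inv A i z) * trans id j j' (crd_inv A i z) =
    trans id k k' (crd_inv A i z) * trans F j k (crd_inv A i z).
  have N1 := near_crd_inv hM ip (nbhs_triv jp).
  have N2 := near_crd_inv hM ip (nbhs_triv kp).
  have N3 := near_crd_inv hM ip (nbhs_triv j'p).
  have N4 := near_crd_inv hM ip (nbhs_triv k'p).
  by near=> z; apply: cocycle; near: z.
have H1 := is_diffE (X p i) (near_eq_is_diff E (is_diff_mul D2 D3)).
have H2 := is_diffE (X p i) (is_diff_mul D4 D1).
have H := etrans (esym H2) H1; rewrite /= (cm_inv hM ip) in H.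
have B1 := beta_change l1 ip ip jp j'p.
have B2 := beta_change l2 ip ip kp k'p.
have cc := cocycle p jp kp j'p k'p.
have n1 : c p != 0 by exact: trans_neq0.
have n2 : c' p != 0 by exact: trans_neq0.
have n3 : g1 p != 0 := trans_neq0 (bundle_iso_id L1) jp j'p.
have n4 : g2 p != 0 := trans_neq0 (bundle_iso_id L2) kp k'p.
exact: (log_derivative_change n1 n2 n3 n4 cc B1 B2 H).
Unshelve. all: by end_near. Qed.

End BundleIso.

(** * Rescaling a bundle by a function *)

Section Twist.
Variables (R : realType) (M : topologicalType) (n : nat) (A : atlas R M n).
Hypothesis hM : complex_manifold A.
Variable L : line_bundle A.
Local Notation C := (Cplx R).
Local Notation T := (total_atlas A L).
Let hL := lb_axioms L.
Let hT := lb_total hL.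

Definition holomorphic_function (h : M -> C) : Prop :=
  forall i p, dom A i p -> differentiable (fun z => h (crd_inv A i z) : C) (crd A i p).

(** An arbitrary choice, as [fib_rescale] holds in all trivializations. *)
Definition local_triv (p : M) : tidx L := sval (cid (lb_cover hL p)).

Lemma local_trivP p : triv (local_triv p) p.
Proof. by rewrite /local_triv; case: cid. Qed.

Definition rescale (h : M -> C) (e : tot L) : tot L :=
  tinv (local_triv (bproj e)) (bproj e) (h (bproj e) * fib (local_triv (bproj e)) e).

Lemma bproj_rescale h e : bproj (rescale h e) = bproj e.
Proof. by rewrite /rescale (lb_proj hL _ (local_trivP (bproj e))). Qed.

Lemma fib_rescale h k e : triv k (bproj e) -> fib k (rescale h e) = h (bproj e) * fib k e.
Proof.
move=> ke; have [c cE] := lb_linear hL (local_trivP (bproj e)) ke.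
rewrite (cE (rescale h e)) ?bproj_rescale // (cE e) //.
by rewrite /rescale (lb_fib hL _ (local_trivP (bproj e))) mulrCA.
Qed.

Lemma fib_inj (k : tidx L) (e e' : tot L) : triv k (bproj e) -> bproj e = bproj e' -> fib k e = fib k e' -> e = e'.
Proof.
move=> ke pe fe; rewrite -(lb_tinv hL ke) pe fe (lb_tinv hL) //.
by rewrite -pe.
Qed.

Lemma rescaleK h h' : (forall p, h' p * h p = 1) -> cancel (rescale h) (rescale h').
Proof.
move=> hh' e; have ke := local_trivP (bproj e).
apply: (@fib_inj (local_triv (bproj e))); rewrite ?bproj_rescale //.
by rewrite !fib_rescale ?bproj_rescale // mulrA hh' mul1r.
Qed.

Lemma rescale_bundle_map h : holomorphic_function h -> bundle_map (rescale h).
Proof.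
move=> dh; split; last 2 first.
- exact: bproj_rescale.
- move=> j k p jp kp; have [c cE] := lb_linear hL jp kp.
  exists (h p * c) => e ep; rewrite fib_rescale ep // (cE e ep).
  by rewrite mulrA.
(* [rescale h] in a chart whose trivialization is used on both sides. *)
pose Phi i (z : 'rV[C]_(n + 1)) : 'rV[C]_(n + 1) :=
  row_mx (lsubmx z) (const_mx (h (crd_inv A i (lsubmx z)) * vert z)).
have PhiE i k e : triv k (bproj e) -> dom A i (bproj e) ->
    crd T (i, k) (rescale h e) = Phi i (crd T (i, k) e).
  move=> ke ie; rewrite /= bproj_rescale fib_rescale // /Phi row_mxKl vert_row_mx.
  by rewrite (cm_inv hM ie).
have dPhi i k e : triv k (bproj e) -> dom A i (bproj e) ->
    differentiable (Phi i) (crd T (i, k) e).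
  move=> ke ie; set x := crd _ _ e.
  have lx : lsubmx x = crd A i (bproj e) by rewrite /x row_mxKl.
  have D1 : is_diff x (fun z : 'rV[C]_(n + 1) => vert z : C) (fun v => vert v : C).
    exact: (is_diff_vert (is_diff_id _)).
  have D2 := is_diff_compE lx (is_diff_lsubmx x) (is_diffP (dh i _ ie)).
  exact: (is_diff_ex (is_diff_row (is_diff_lsubmx x) (is_diff_mul D2 D1))).
have nearE i k e : triv k (bproj e) -> dom A i (bproj e) ->
    \forall e' \near e, rescale h e' = crd_inv T (i, k) (Phi i (crd T (i, k) e')).
  move=> ke ie.
  have De : dom T (i, k) e by split.
  have N : nbhs e (dom T (i, k)) by apply: open_nbhs_nbhs; split => //; exact: (cm_open_dom hT).
  apply: filterS N => e' [/= ie' ke'].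
  have DF : dom T (i, k) (rescale h e') by rewrite /= bproj_rescale.
  exact: (etrans (esym (cm_inv hT DF)) (congr1 (crd_inv T (i, k)) (PhiE i k e' ke' ie'))).
split.
  move=> e; have ke := local_trivP (bproj e); set k := local_triv _ in ke.
  have [i ie] := cm_cover hM (bproj e).
  have De : dom T (i, k) e by split.
  have DFe : dom T (i, k) (rescale h e) by rewrite /= bproj_rescale.
  have c1 : {for e, continuous (crd T (i, k))} by exact: (cm_crd_cont hT De).
  have c2 : {for crd T (i, k) e, continuous (Phi i)}.
    exact: (differentiable_continuous (dPhi i k e ke ie)).
  have c3 : {for Phi i (crd T (i, k) e), continuous (crd_inv T (i, k))}.
    rewrite -PhiE //; exact: (cm_inv_cont hT DFe).
  have E : rescale h e = crd_inv T (i, k) (Phi i (crd T (i, k) e)).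
    exact: (nbhs_singleton (nearE i k e ke ie)).
  have c4 : (fun e' => crd_inv T (i, k) (Phi i (crd T (i, k) e'))) @ e --> rescale h e.
    rewrite E; exact: (cvg_comp _ _ (cvg_comp _ _ c1 c2) c3).
  apply: cvg_trans c4; apply: near_eq_cvg.
  by apply: filterS (nearE i k e ke ie) => e' ->.
move=> e [i k] [i' k'] De DFe; have [/= ie ke] := De.
have E0 := PhiE i k e ke ie.
have DFe1 : dom T (i, k) (rescale h e) by rewrite /= bproj_rescale.
have D1 := cm_compat hT DFe1 DFe.
have D2 := is_diff_compE (esym E0) (is_diffP (dPhi i k e ke ie)) (is_diffP D1).
apply: (near_eq_diff _ (is_diff_ex D2)).
have N1 := near_total hM (fib k e) ie ke (nbhs_triv ke).
have N2 := near_total hM (fib k e) ie ke (nbhs_dom hM ie).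
have N3 : \forall z \near crd T (i, k) e, crd A i (crd_inv A i (lsubmx z)) = lsubmx z.
  apply: (near_lsubmx (P := fun w => crd A i (crd_inv A i w) = w)).
  by rewrite row_mxKl; exact: near_crdK.
near=> z.
have z1 : triv k (crd_inv A i (lsubmx z)) by near: z.
have z2 : dom A i (crd_inv A i (lsubmx z)) by near: z.
have z3 : crd A i (crd_inv A i (lsubmx z)) = lsubmx z by near: z.
have zE : z = crd T (i, k) (crd_inv T (i, k) z).
  by rewrite -[z in RHS]row_mx_vert total_crd_invE total_crdE // z3 row_mx_vert.
rewrite {1}zE; rewrite /comp.
set e' := crd_inv T (i, k) z.
have pe' : bproj e' = crd_inv A i (lsubmx z).
  by rewrite /e' -[z in LHS]row_mx_vert total_crd_invE (lb_proj hL).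
have i'e : dom A i (bproj e') by rewrite pe'.
have ke' : triv k (bproj e') by rewrite pe'.
have DF : dom T (i, k) (rescale h e') by rewrite /= bproj_rescale.
have E1 := etrans (esym (cm_inv hT DF)) (congr1 (crd_inv T (i, k)) (PhiE i k e' ke' i'e)).
by rewrite E1.
Unshelve. all: by end_near. Qed.

Lemma rescale_bundle_iso h : holomorphic_function h -> (forall p, h p != 0) ->
  bundle_iso (rescale h).
Proof.
move=> dh h0; split; first exact: rescale_bundle_map.
exists (rescale (fun p => (h p)^-1)); split.
- apply: rescale_bundle_map => i p ip.
  apply: (@differentiableV _ _ (fun z => h (crd_inv A i z))); first exact: dh.
  by rewrite (cm_inv hM ip).
- by apply: rescaleK => p; rewrite mulVf.
- by apply: rescaleK => p; rewrite mulfV.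
Qed.

End Twist.

Lemma bundle_iso_comp (R : realType) (M : topologicalType) (n : nat) (A : atlas R M n)
    (L1 L2 L3 : line_bundle A) (F : tot L1 -> tot L2) (G : tot L2 -> tot L3) :
  bundle_iso F -> bundle_iso G -> bundle_iso (G \o F).
Proof.
move=> [hF [F' [hF' FK KF]]] [hG [G' [hG' GK KG]]].
split; first exact: bundle_map_comp hF hG.
by exists (F' \o G'); split; [exact: bundle_map_comp hG' hF' | exact: can_comp..].
Qed.

(** * Lifts as linear maps *)

Section LiftMap.
Variables (R : realType) (M : topologicalType) (n : nat) (A : atlas R M n).
Variable g : set (field_family A).

Lemma pushforwardP (S : topologicalType) m (B : atlas R S m) (f : S -> M) (X : field_family B) :
  projectable A f X ->
  vector_field A (Defs.pushforward A f X) /\ related f X (Defs.pushforward A f X).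
Proof.
move=> pX; rewrite /Defs.pushforward; case: pselect => // pX'.
by case: (cid2 pX').
Qed.

(** [hat] is the inverse of the projection of [gh] onto [g]. *)
Record lift_map (L : line_bundle A) (gh : set (field_family (total_atlas A L)))
    (hat : field_family A -> field_family (total_atlas A L)) : Prop := LiftMap {
  hat_in : forall X, g X -> gh (hat X);
  hat_lifts : forall X, g X -> lifts (hat X) X;
  hat_onto : forall Xh, gh Xh -> exists2 X, g X & Xh = hat X;
  hat_lin : forall a X Y, g X -> g Y -> hat (vf_lin a X Y) = vf_lin a (hat X) (hat Y);
  hat_bracket : forall X Y, g X -> g Y -> hat (bracket X Y) = bracket (hat X) (hat Y) }.

Lemma lift_map_ex (L : line_bundle A) (gh : set (field_family (total_atlas A L))) :
  lie_algebra_of_vf g -> is_lift g gh -> exists hat, lift_map gh hat.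
Proof.
move=> [_ [_ glin] gbr] [[ghv [_ ghlin] ghbr] proj eul [[fun_ inj surj] lin br]].
pose phi : field_family (total_atlas A L) -> field_family A := Defs.pushforward A (@bproj R M L).
have ex X : g X -> exists Xh, gh Xh /\ phi Xh = X.
  by move=> gX; have [Xh ghX E] := surj _ gX; exists Xh.
pose hat X := match pselect (g X) with
  | left gX => sval (cid (ex X gX)) | right _ => vf_zero _ end.
have hatP X : g X -> gh (hat X) /\ phi (hat X) = X.
  by move=> gX; rewrite /hat; case: pselect => // gX'; case: cid.
have hat_uniq X Xh : g X -> gh Xh -> phi Xh = X -> hat X = Xh.
  move=> gX ghX E; have [h1 h2] := hatP X gX.
  by apply: inj; rewrite ?inE //; rewrite -/phi h2 E.
exists hat; split.
- by move=> X /hatP[].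
- move=> X gX; have [h1 h2] := hatP X gX; split; [exact: ghv| |exact: eul].
  by have [_] := pushforwardP (proj _ h1); rewrite -/phi h2.
- move=> Xh ghX; exists (phi Xh); first exact: fun_.
  by apply/esym/hat_uniq => //; exact: fun_.
- move=> a X Y gX gY; have [h1 h2] := hatP X gX; have [h3 h4] := hatP Y gY.
  apply: hat_uniq; [exact: glin|exact: ghlin|].
  by rewrite /phi lin // -/phi h2 h4.
- move=> X Y gX gY; have [h1 h2] := hatP X gX; have [h3 h4] := hatP Y gY.
  apply: hat_uniq; [exact: gbr|exact: ghbr|].
  by rewrite /phi br // -/phi h2 h4.
Qed.

End LiftMap.

(** * The closed 1-form of two lifts *)

Section DefectForm.
Variables (R : realType) (M : topologicalType) (n : nat) (A : atlas R M n).
Hypothesis hM : complex_manifold A.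
Local Notation C := (Cplx R).
Variable g : set (field_family A).
Hypothesis hg : lie_algebra_of_vf g.
Hypothesis htr : transitive_vf g.
Hypothesis hiso : forall p : M, ~ exists h : set (field_family A),
  ideal (isotropy g p) h /\ codim1 (isotropy g p) h.
Variables L1 L2 : line_bundle A.
Variables (gh1 : set (field_family (total_atlas A L1))).
Variables (gh2 : set (field_family (total_atlas A L2))).
Variables (hat1 : field_family A -> field_family (total_atlas A L1)).
Variables (hat2 : field_family A -> field_family (total_atlas A L2)).
Hypotheses (H1 : lift_map g gh1 hat1) (H2 : lift_map g gh2 hat2).
Variables (j : tidx L1) (k : tidx L2).

Definition defect (X : field_family A) i p : C := beta (hat2 X) i k p - beta (hat1 X) i j p.

Lemma vf_in X i p : g X -> dom A i p -> differentiable (vf_comp X i) (crd A i p).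
Proof. by have [gv _ _] := hg; move=> /gv[_ dX] /dX. Qed.

Lemma vf_ext i p v : dom A i p -> exists X, g X /\ X p i = v.
Proof.
move=> ip; have [w tw wv] := tangent_extend hM v ip.
have : [set X p | X in g] w by rewrite (htr p).
by move=> [X gX E]; exists X; split => //; rewrite E.
Qed.

Lemma defect_lin a X Y i p : g X -> g Y ->
  defect (vf_lin a X Y) i p = a * defect X i p + defect Y i p.
Proof.
move=> gX gY; rewrite /defect (hat_lin H1) // (hat_lin H2) // /beta /vf_lin /vert !mxE.
ring.
Qed.

Section Point.
Variables (i : idx A) (p : M).
Hypotheses (ip : dom A i p) (jp : triv j p) (kp : triv k p).

Lemma defect_differentiable X : g X ->
  differentiable (fun z => defect X i (crd_inv A i z) : C) (crd A i p).
Proof.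
move=> gX; have D1 := beta_differentiable (hat_lifts H1 gX) ip jp.
have D2 := beta_differentiable (hat_lifts H2 gX) ip kp.
exact: (differentiableB D2 D1).
Qed.

Lemma defect_bracket X Y : g X -> g Y ->
  defect (bracket X Y) i p =
  'd (fun z => defect Y i (crd_inv A i z) : C) (crd A i p) (X p i) -
  'd (fun z => defect X i (crd_inv A i z) : C) (crd A i p) (Y p i).
Proof.
move=> gX gY; rewrite /defect (hat_bracket H1 gX gY) (hat_bracket H2 gX gY).
rewrite (beta_bracket hM (hat_lifts H1 gX) (hat_lifts H1 gY) ip jp).
rewrite (beta_bracket hM (hat_lifts H2 gX) (hat_lifts H2 gY) ip kp).
have dB Z (gZ : g Z) := is_diffB
  (is_diffP (beta_differentiable (hat_lifts H2 gZ) ip kp))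
  (is_diffP (beta_differentiable (hat_lifts H1 gZ) ip jp)).
have E1 := is_diffE (X p i) (dB _ gY); have E2 := is_diffE (Y p i) (dB _ gX).
apply: etrans _ (esym (congr2 (fun a b => a - b) E1 E2)).
exact: subr_subACA.
Qed.

Lemma defect_chart X i' : g X -> dom A i' p -> defect X i' p = defect X i p.
Proof.
move=> gX i'p; rewrite /defect (beta_chart hM (hat_lifts H1 gX) ip i'p jp).
by rewrite (beta_chart hM (hat_lifts H2 gX) ip i'p kp).
Qed.

(** Otherwise the fields of the isotropy algebra with vanishing defect at [p]
    would form an ideal of codimension 1: by [defect_bracket] the defect at [p]
    of a bracket of two fields that vanish at [p] is zero. *)
Lemma defect_isotropy X : isotropy g p X -> defect X i p = 0.
Proof.
have [gv [g0 glin] gbr] := hg.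
move=> [gX X0]; apply/eqP/negPn/negP => /eqP dX; apply: (hiso (p := p)).
exists [set Y | isotropy g p Y /\ defect Y i p = 0].
have klin a Y Z : isotropy g p Y -> isotropy g p Z -> isotropy g p (vf_lin a Y Z).
  move=> [gY Y0] [gZ Z0]; split; first exact: glin.
  by apply/funext => l; rewrite /vf_lin Y0 Z0 scaler0 addr0.
have k0 : isotropy g p (vf_zero A) by [].
have d0 : defect (vf_zero A) i p = 0.
  have E : vf_lin 0 X X = X.
    by apply/funext => q; apply/funext => l; rewrite /vf_lin scale0r add0r.
  have E2 : vf_lin (-1) X X = vf_zero A.
    by apply/funext => q; apply/funext => l; rewrite /vf_lin /vf_zero scaleN1r addNr.
  by rewrite -E2 defect_lin // mulN1r addNr.
split.
  split; first by move=> Y [].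
    split => // a Y Z [kY dY] [kZ' dZ]; split; first exact: klin.
    by rewrite defect_lin ?dY ?dZ ?mulr0 ?addr0 //; [case: kY|case: kZ'].
  move=> Y Z [gY Y0] [[gZ Z0] dZ]; split; [split|].
  - exact: gbr.
  - apply/funext => l; rewrite /bracket; case: asboolP => // lp.
    have Yl : Y p l = 0 by rewrite Y0.
    have Zl : Z p l = 0 by rewrite Z0.
    exact: (subr_eq0_0 (diff_eq0 _ _ Yl) (diff_eq0 _ _ Zl)).
  - have Yi : Y p i = 0 by rewrite Y0.
    have Zi : Z p i = 0 by rewrite Z0.
    apply: (etrans (defect_bracket gY gZ)).
    exact: (subr_eq0_0 (diff_eq0 _ _ Yi) (diff_eq0 _ _ Zi)).
exists X; first by split => // -[].
move=> Y kY; pose a := defect Y i p / defect X i p.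
have kX : isotropy g p X by [].
exists a, (vf_lin (- a) X Y).
  split; first exact: klin.
  rewrite defect_lin //; last by case: kY.
  by rewrite mulNr divfK ?addNr //; apply/eqP.
apply/funext => q; apply/funext => l; rewrite /vf_lin scaleNr addrA subrr add0r //.
Qed.

Lemma defect_point X Y : g X -> g Y -> X p i = Y p i -> defect X i p = defect Y i p.
Proof.
have [gv [g0 glin] gbr] := hg.
move=> gX gY XY.
have E : X p = Y p.
  by apply: (tangent_inj ip _ _ XY); [exact: (gv _ gX).1 | exact: (gv _ gY).1].
have : defect (vf_lin (-1) Y X) i p = 0.
  apply: defect_isotropy; split; first exact: glin.
  by apply/funext => l; rewrite /vf_lin E scaleN1r addNr.
by rewrite defect_lin // mulN1r addrC => /subr0_eq.
Qed.

End Point.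

(** The value on [v] is the defect of any field of [g] with coordinates [v] at
    [p]; by [defect_point] the choice does not matter. *)
Definition dform p i (v : 'rV[C]_n) : C :=
  match pselect (exists X, g X /\ X p i = v) with
  | left ex => defect (sval (cid ex)) i p
  | right _ => 0
  end.

Section Form.
Variables (i : idx A) (p : M).
Hypotheses (ip : dom A i p) (jp : triv j p) (kp : triv k p).

Lemma dformE X : g X -> dform p i (X p i) = defect X i p.
Proof.
move=> gX; rewrite /dform; case: pselect => [ex|[]]; last by exists X.
by case: cid => Y /= [gY E]; apply: defect_point.
Qed.

End Form.

Section FormAlgebra.
Variables (i : idx A) (p : M).
Hypotheses (ip : dom A i p) (jp : triv j p) (kp : triv k p).

Lemma dform_lin c x y : dform p i (c *: x + y) = c * dform p i x + dform p i y.
Proof.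
have [gv [g0 glin] gbr] := hg.
have [X [gX <-]] := vf_ext x ip; have [Y [gY <-]] := vf_ext y ip.
rewrite -[_ + _]/(vf_lin c X Y p i) !(dformE ip jp kp) //; last exact: glin.
exact: defect_lin.
Qed.

(** The defect does not depend on the chart of the base, so the form has the
    same values on the coordinates of a tangent vector in any chart. *)
Lemma dform_compat i' v : dom A i' p ->
  dform p i v = dform p i' ('d (crd A i' \o crd_inv A i) (crd A i p) v).
Proof.
move=> i'p; have [X [gX <-]] := vf_ext v ip.
have [gv _ _] := hg.
rewrite -((gv _ gX).1 p).2 // (dformE ip jp kp gX) (dformE i'p jp kp gX).
exact: esym (defect_chart ip jp kp gX i'p).
Qed.

Lemma dform_sum v : dform p i v = \sum_m v 0 m * dform p i (delta_mx 0 m).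
Proof.
have l0 : dform p i 0 = 0.
  have := dform_lin 1 0 0; rewrite scaler0 addr0 mul1r => /eqP.
  by rewrite -subr_eq0 opprD addrA subrr add0r oppr_eq0 => /eqP.
rewrite {1}(row_sum_delta v).
elim/big_rec2 : _ => [//|m y x _ <-].
by rewrite dform_lin.
Qed.

End FormAlgebra.

Section FormCalculus.
Variables (i : idx A) (p : M).
Hypotheses (ip : dom A i p) (jp : triv j p) (kp : triv k p).

Let near_all : \forall z \near crd A i p,
  [/\ dom A i (crd_inv A i z), triv j (crd_inv A i z) & triv k (crd_inv A i z)].
Proof.
have N1 := near_dom hM ip; have N2 := near_crd_inv hM ip (nbhs_triv jp).
have N3 := near_crd_inv hM ip (nbhs_triv kp).
by near=> z; split; near: z.
Unshelve. all: by end_near. Qed.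

(** Fields of [g] spanning the tangent space at [p] form a frame nearby, and the
    coefficients of the form in the coordinate frame solve a linear system with
    holomorphic coefficients. *)
Lemma dform_differentiable v :
  differentiable (fun z => dform (crd_inv A i z) i v : C) (crd A i p).
Proof.
have [X XP] := choice (fun l : 'I_n => vf_ext (delta_mx 0 l) ip).
have De m : differentiable (fun z => dform (crd_inv A i z) i (delta_mx 0 m) : C) (crd A i p).
  pose N (z : 'rV[C]_n) : 'M[C]_n := \matrix_(l, m) X l (crd_inv A i z) i 0 m.
  pose a (z : 'rV[C]_n) : 'cV[C]_n := \col_m dform (crd_inv A i z) i (delta_mx 0 m).
  pose b (z : 'rV[C]_n) : 'cV[C]_n := \col_l defect (X l) i (crd_inv A i z).
  have := @differentiable_solve _ _ n N a b (crd A i p).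
  have dN l m' : differentiable (fun z => N z l m' : C) (crd A i p).
    have D := is_diff_coord 0 m' (is_diffP (vf_in (XP l).1 ip)).
    by apply: (near_eq_diff _ (is_diff_ex D)); near=> z; rewrite /N mxE.
  have db l : differentiable (fun z => b z l 0 : C) (crd A i p).
    have D := defect_differentiable ip jp kp (XP l).1.
    by apply: (near_eq_diff _ D); near=> z; rewrite /b mxE.
  move=> /(_ dN db) K.
  have det1 : \det (N (crd A i p)) != 0.
    suff -> : N (crd A i p) = 1%:M by rewrite det1 oner_eq0.
    by apply/matrixP => l m'; rewrite !mxE (cm_inv hM ip) (XP l).2 !mxE eqxx /= eq_sym.
  have E : \forall z \near crd A i p, N z *m a z = b z.
    near=> z; have [iz jz kz] : [/\ dom A i (crd_inv A i z), triv j (crd_inv A i z) &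
      triv k (crd_inv A i z)] by near: z.
    apply/colP => l; rewrite !mxE -(dformE iz jz kz (XP l).1) (dform_sum iz jz kz).
    by apply: eq_bigr => m' _; rewrite !mxE.
  have D := K det1 E m.
  by apply: (near_eq_diff _ D); near=> z; rewrite /a mxE.
have D := @differentiable_big_sum _ _ _ _ (index_enum 'I_n) xpredT
  (fun m z => v 0 m * dform (crd_inv A i z) i (delta_mx 0 m) : C) (crd A i p).
apply: (near_eq_diff _ (D _)).
  near=> z; have [iz jz kz] : [/\ dom A i (crd_inv A i z), triv j (crd_inv A i z) &
    triv k (crd_inv A i z)] by near: z.
  by rewrite (dform_sum iz jz kz).
move=> m; apply: (@differentiableM _ _ (cst (v 0 m : C))) => //.
Unshelve. all: by end_near. Qed.

(** The defect of [Y] is the form evaluated on [Y]: product rule in the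
    coordinate frame. *)
Lemma diff_defect Y v : g Y ->
  'd (fun z => defect Y i (crd_inv A i z) : C) (crd A i p) v =
  dform p i ('d (vf_comp Y i) (crd A i p) v) +
  'd (fun z => dform (crd_inv A i z) i (Y p i) : C) (crd A i p) v.
Proof.
move=> gY.
have near_sum (w : 'rV[C]_n) : \forall z \near crd A i p,
    \sum_m (w 0 m) * dform (crd_inv A i z) i (delta_mx 0 m) = dform (crd_inv A i z) i w :> C.
  near=> z; have [iz jz kz] : [/\ dom A i (crd_inv A i z), triv j (crd_inv A i z) &
    triv k (crd_inv A i z)] by near: z.
  by rewrite (dform_sum iz jz kz w).
have near_defect : \forall z \near crd A i p,
    \sum_m (vf_comp Y i z 0 m) * dform (crd_inv A i z) i (delta_mx 0 m) =
    defect Y i (crd_inv A i z) :> C.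
  near=> z; have [iz jz kz] : [/\ dom A i (crd_inv A i z), triv j (crd_inv A i z) &
    triv k (crd_inv A i z)] by near: z.
  by rewrite -(dformE iz jz kz gY) (dform_sum iz jz kz).
have Dm m := is_diffP (dform_differentiable (delta_mx 0 m)).
have DY m := is_diff_coord 0 m (is_diffP (vf_in gY ip)).
have D1 := is_diff_big_sum (index_enum 'I_n) (fun m => is_diff_mul (DY m) (Dm m)).
have D2 := is_diff_big_sum (index_enum 'I_n)
  (fun m => is_diff_mul (is_diff_cst (Y p i 0 m : C) _) (Dm m)).
have E1 := is_diffE v (near_eq_is_diff near_defect D1).
have E2 := is_diffE v (near_eq_is_diff (near_sum (Y p i)) D2).
apply: (etrans E1); apply: esym; apply: (etrans (congr1 (fun x => _ + x) E2)).
rewrite (dform_sum ip jp kp) -big_split; apply: eq_bigr => m _ /=.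
rewrite /vf_comp (cm_inv hM ip) mulr0 addr0 addrC; congr (_ + _).
by rewrite mulrC.
Unshelve. all: by end_near. Qed.

(** Both sides of the cocycle identity for fields with values [v0] and [v1] at
    [p] contain the value of the form on their bracket; what remains is the
    exterior derivative on [(v0, v1)]. *)
Lemma dform_closed v0 v1 :
  'd (fun z => dform (crd_inv A i z) i v1 : C) (crd A i p) v0 =
  'd (fun z => dform (crd_inv A i z) i v0 : C) (crd A i p) v1.
Proof.
have [gv _ gbr] := hg.
have [X [gX <-]] := vf_ext v0 ip; have [Y [gY <-]] := vf_ext v1 ip.
have B := defect_bracket ip jp kp gX gY.
have B' := etrans B (congr2 (fun a b => a - b) (diff_defect (X p i) gY) (diff_defect (Y p i) gX)).
have lin := dform_lin ip jp kp.
have linB x y : dform p i (x - y) = dform p i x - dform p i y.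
  by rewrite addrC -scaleN1r lin mulN1r addrC.
have E := etrans (esym (dformE ip jp kp (gbr _ _ gX gY)))
  (etrans (congr1 (dform p i) (bracketE X Y ip)) (linB _ _)).
exact: subr0_eq (sub_add_cancel (etrans (esym E) B')).
Qed.

End FormCalculus.
End DefectForm.

(** * The class in de Rham cohomology *)

Section Cech.
Variables (R : realType) (M : topologicalType) (n : nat) (A : atlas R M n).
Hypothesis hM : complex_manifold A.
Local Notation C := (Cplx R).
Variable g : set (field_family A).
Hypothesis hg : lie_algebra_of_vf g.
Hypothesis htr : transitive_vf g.
Hypothesis hH : deRham_trivial A 1.
Hypothesis hiso : forall p : M, ~ exists h : set (field_family A),
  ideal (isotropy g p) h /\ codim1 (isotropy g p) h.
Variables L1 L2 : line_bundle A.
Variables (gh1 : set (field_family (total_atlas A L1))).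
Variables (gh2 : set (field_family (total_atlas A L2))).
Variables (hat1 : field_family A -> field_family (total_atlas A L1)).
Variables (hat2 : field_family A -> field_family (total_atlas A L2)).
Hypotheses (H1 : lift_map g gh1 hat1) (H2 : lift_map g gh2 hat2).
Variable F : tot L1 -> tot L2.
Hypothesis isoF : bundle_iso F.

(** Two trivializations together with a factor that brings the matrix of [F] into the
    half plane where the logarithm is defined. *)
Definition log_index : Type := (tidx L1 * tidx L2 * C)%type.

Definition index_trans (s : log_index) (p : M) : C := trans F s.1.1 s.1.2 p.

Definition log_domain (s : log_index) : set M :=
  [set p | [/\ triv s.1.1 p, triv s.1.2 p & 0 < @complex.Re R (s.2 * index_trans s p)]].

Definition index_form (s : log_index) p i (v : 'rV[C]_n) : C := dform g hat1 hat2 s.1.1 s.1.2 p i v.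

Definition log_trans (s : log_index) p : C := clog (s.2 * index_trans s p).

Lemma index_trans_is_diff s i p : dom A i p -> log_domain s p ->
  is_diff (crd A i p) (fun z => index_trans s (crd_inv A i z) : C)
    ('d (fun z => index_trans s (crd_inv A i z) : C) (crd A i p)).
Proof.
move=> ip [jp kp _]; exact: (is_diffP (trans_differentiable (proj1 isoF) ip jp kp)).
Qed.

Lemma log_domain_open s : open (log_domain s).
Proof.
rewrite openE => p ps; have [jp kp rp] := ps; rewrite /interior.
have [i ip] := cm_cover hM p.
have cI : {for crd A i p, continuous (fun z => index_trans s (crd_inv A i z) : C)}.
  exact: (differentiable_continuous (is_diff_ex (index_trans_is_diff ip ps))).
have cc : (fun q => index_trans s (crd_inv A i (crd A i q)) : C) @ p --> index_trans s p.
  have := cvg_comp _ _ (cm_crd_cont hM ip) cI; rewrite (cm_inv hM ip) => Hc; exact: Hc.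
have N1 := nbhs_triv jp; have N2 := nbhs_triv kp; have N3 := nbhs_dom hM ip.
have P : nbhs (index_trans s p) [set w : C | 0 < @complex.Re R (s.2 * w)].
  have sc : {for index_trans s p, continuous (fun w : C => s.2 * w)}.
    exact: (scaler_continuous (V := C)).
  have Q : nbhs (s.2 * index_trans s p) [set w : C | 0 < @complex.Re R w].
    have N : nbhs (@complex.Re R (s.2 * index_trans s p)) [set x : R | 0 < x] by exact: lt_nbhsr.
    exact: (@continuous_Re R (s.2 * index_trans s p) _ N).
  exact: (sc _ Q).
have N4 : \forall q \near p, 0 < @complex.Re R (s.2 * index_trans s (crd_inv A i (crd A i q))).
  exact: (cc _ P).
have : \forall q \near p, [/\ triv s.1.1 q, triv s.1.2 q, dom A i q &
    0 < @complex.Re R (s.2 * index_trans s (crd_inv A i (crd A i q)))].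
  by near=> q; split; near: q.
by apply: filterS => q [jq kq iq]; rewrite (cm_inv hM iq) => rq; split.
Unshelve. all: by end_near. Qed.

Lemma log_domain_cover : open_cover log_domain.
Proof.
split; first exact: log_domain_open.
move=> p; have [j jp] := lb_cover (lb_axioms L1) p.
have [k kp] := lb_cover (lb_axioms L2) p.
exists (j, k, (trans F j k p)^-1); split => //=.
by rewrite /index_trans /= mulVf ?(trans_neq0 isoF jp kp) //= ltr01.
Qed.

Lemma log_trans_is_diff s i p : dom A i p -> log_domain s p ->
  is_diff (crd A i p) (fun z => log_trans s (crd_inv A i z) : C)
    (fun v => (index_trans s p)^-1 * 'd (fun z => index_trans s (crd_inv A i z) : C) (crd A i p) v).
Proof.
move=> ip ps; have [jp kp rp] := ps.
have D1 := index_trans_is_diff ip ps.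
have D2 := is_diff_mul (is_diff_cst (s.2 : C) _) D1.
have Ep : s.2 * index_trans s (crd_inv A i (crd A i p)) = s.2 * index_trans s p by rewrite (cm_inv hM ip).
have D3 := is_diff_compE (f := fun y => s.2 * index_trans s (crd_inv A i y)) Ep D2 (is_diff_clog rp).
have c0 : index_trans s p != 0 := trans_neq0 isoF jp kp.
have s0 : s.2 != 0 by apply/eqP => E; move: rp; rewrite E mul0r /= ltxx.
apply: (eq_is_diff D3) => v /=.
by rewrite mulr0 addr0 invfM [s.2^-1 * _]mulrC -mulrA mulKf.
Qed.

(** This is [defect_invariant], the right-hand side being the difference of the
    logarithmic derivatives of the two matrices of [F]. *)
Lemma index_form_log_trans s t i p v : dom A i p -> log_domain s p -> log_domain t p ->
  index_form t p i v - index_form s p i v =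
  'd (fun z => log_trans t (crd_inv A i z) : C) (crd A i p) v -
  'd (fun z => log_trans s (crd_inv A i z) : C) (crd A i p) v.
Proof.
move=> ip ps pt; have [jp kp _] := ps; have [j'p k'p _] := pt.
have [X [gX Xv]] := vf_ext hM htr v ip.
have E := defect_invariant hM isoF (hat_lifts H1 gX) (hat_lifts H2 gX) ip jp kp j'p k'p.
rewrite /index_form -Xv (dformE hM hg hiso H1 H2 ip jp kp gX) (dformE hM hg hiso H1 H2 ip j'p k'p gX).
have Et := is_diffE (X p i) (log_trans_is_diff ip pt).
have Es := is_diffE (X p i) (log_trans_is_diff ip ps).
apply: (etrans _ (esym (congr2 (fun a b => a - b) Et Es))).
by apply/eqP; rewrite -subr_eq0 subr_subACA subr_eq0; apply/eqP; exact: E.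
Qed.

(** The forms in bidegree (0, 1) and the differences of the logarithms in
    bidegree (1, 0). *)
Definition defect_cochain : cochain_family A log_index := fun a b =>
  match a, b return ('I_a.+1 -> log_index) -> form_family A b with
  | 0, 1 => fun s p i v => index_form (s ord0) p i (v ord0)
  | 1, 0 => fun s p i v => log_trans (s ord_max) p - log_trans (s ord0) p
  | _, _ => fun s p i v => 0
  end.

Lemma zero_form b (V : set M) : holomorphic_form V (fun (p : M) (i : idx A) (v : 'I_b -> 'rV[C]_n) => 0).
Proof.
by split=> // *; rewrite mulr0 addr0.
Qed.

Lemma exterior_d0 b p i v :
  exterior_d (fun (p : M) (i : idx A) (v : 'I_b -> 'rV[C]_n) => 0) p i v = 0.
Proof.
rewrite /exterior_d big1 // => a _.
by rewrite (diff_cst (0 : C^o)) mulr0.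
Qed.

Lemma exterior_d_function (w : form_family A 0) p i v :
  exterior_d w p i v =
  'd (fun z => w (crd_inv A i z) i (v \o lift ord0)) (crd A i p) (v ord0).
Proof. by rewrite /exterior_d big_ord1 expr0 mul1r. Qed.

Lemma exterior_d_1form (w : form_family A 1) p i v :
  exterior_d w p i v =
  'd (fun z => w (crd_inv A i z) i (fun=> v ord_max)) (crd A i p) (v ord0) -
  'd (fun z => w (crd_inv A i z) i (fun=> v ord0)) (crd A i p) (v ord_max).
Proof.
have e1 : lift ord0 ord0 = ord_max :> 'I_2 by apply: val_inj.
have e2 : v \o lift ord0 = fun=> v ord_max.
  by apply/funext => x; rewrite /= ord1 e1.
have e3 : v \o lift ord_max = fun=> v ord0.
  by apply/funext => x; rewrite /= ord1; congr v; apply: val_inj.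
by rewrite /exterior_d big_ord_recl big_ord1 e1 e2 e3 expr0 mul1r expr1 mulN1r.
Qed.

Lemma cech_d_0cochain (I : Type) b (c : ('I_1 -> I) -> form_family A b) (s : 'I_2 -> I) p i v :
  cech_d c s p i v = c (fun=> s ord_max) p i v - c (fun=> s ord0) p i v.
Proof.
have e1 : lift ord0 ord0 = ord_max :> 'I_2 by apply: val_inj.
have e2 : s \o lift ord0 = fun=> s ord_max.
  by apply/funext => x; rewrite /= ord1 e1.
have e3 : s \o lift ord_max = fun=> s ord0.
  by apply/funext => x; rewrite /= ord1; congr s; apply: val_inj.
by rewrite /cech_d big_ord_recl big_ord1 e1 e2 e3 expr0 mul1r expr1 mulN1r.
Qed.

Lemma cech_d0 a b s p i v :
  cech_d (fun (s : 'I_a.+1 -> log_index) (p : M) (i : idx A) (v : 'I_b -> 'rV[C]_n) => 0) s p i v = 0.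
Proof. by rewrite /cech_d big1 // => l _; rewrite mulr0. Qed.

Lemma defect_cochainP : cochain log_domain (fun d => d == 1)%N defect_cochain.
Proof.
move=> a b s; split; last first.
  by case: a s => [|[|a]] s; case: b => [|[|b]].
case: a s => [|[|a]] s; case: b => [|[|b]]; try exact: zero_form.
- have us p : inter log_domain s p -> [/\ triv (s ord0).1.1 p, triv (s ord0).1.2 p & log_domain (s ord0) p].
    by move=> H; have [? ? ?] := H ord0; split => //; exact: H.
  split=> /=.
  + move=> p i v a c x y /us[jp kp _] ip; rewrite !(ord1 a) /upd eqxx.
    exact: (dform_lin hM hg htr hiso H1 H2 ip jp kp).
  + by move=> p i v a b _ _; rewrite !ord1 eqxx.
  + move=> p i i' v /us[jp kp _] ip i'p.
    exact: (dform_compat hM hg htr hiso H1 H2 ip jp kp).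
  + move=> p i v /us[jp kp _] ip.
    exact: (dform_differentiable hM hg htr hiso H1 H2 ip jp kp).
- split.
  + by move=> p i v [].
  + by move=> p i v [].
  + by [].
  move=> p i v H ip.
  have D1 := is_diff_ex (log_trans_is_diff ip (H ord0)).
  have D2 := is_diff_ex (log_trans_is_diff ip (H ord_max)).
  exact: (differentiableB D2 D1).
Qed.

Lemma defect_cochain_closed a b (s : 'I_a.+1 -> log_index) p i v :
  inter log_domain s p -> dom A i p -> total_d defect_cochain (b := b) s p i v = 0.
Proof.
move=> sp ip.
(* The bidegrees with a condition are (0, 2), where the forms are closed, (1, 1),
   which is [index_form_log_trans], and (2, 0), where differences telescope. *)
case: a s sp => [|[|[|a]]] s sp; case: b v => [|[|[|b]]] v; rewrite /total_d /=;
  rewrite ?add0r ?addr0 ?expr0 ?mul1r ?cech_d0 ?exterior_d0 ?mulr0 ?add0r ?addr0 //.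
- rewrite exterior_d_1form; have [jp kp _] := sp ord0.
  apply/eqP; rewrite subr_eq0; apply/eqP.
  exact: (dform_closed hM hg htr hiso H1 H2 ip jp kp).
- rewrite cech_d_0cochain exterior_d_function expr1 mulN1r.
  apply/eqP; rewrite subr_eq0; apply/eqP.
  apply: (etrans (index_form_log_trans (v ord0) ip (sp ord0) (sp ord_max))).
  have D := is_diffB (is_diffP (is_diff_ex (log_trans_is_diff ip (sp ord_max))))
    (is_diffP (is_diff_ex (log_trans_is_diff ip (sp ord0)))).
  exact: esym (is_diffE (v ord0) D).
- rewrite /cech_d !big_ord_recl big_ord0 /=.
  have s_at (x y : 'I_3) : val x = val y -> s x = s y by move=> /val_inj ->.
  rewrite -(s_at ord0 (lift (lift ord0 ord0) ord0)) //.
  rewrite -(s_at ord_max (lift (lift ord0 ord0) ord_max)) //.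
  rewrite -(s_at ord_max (lift ord0 ord_max)) //.
  rewrite -(s_at ord0 (lift (lift ord0 (lift ord0 ord0)) ord0)) //.
  rewrite -(s_at (lift ord0 ord0) (lift (lift ord0 (lift ord0 ord0)) ord_max)) //.
  rewrite expr0 mul1r expr1 mulN1r sqrrN expr1n mul1r addr0.
  by rewrite opprB; exact: telescope3.
Qed.

(** Trivializing the cocycle on a refinement gives functions [f] with
    differential the form; the functions [f - log_trans] agree on overlaps, and
    [h] is the exponential of their common value. *)
Lemma rescaling_factor : exists h : M -> C, [/\ holomorphic_function A h, forall p, h p != 0 &
  forall i j k p X, g X -> dom A i p -> triv j p -> triv k p ->
    'd (fun z => h (crd_inv A i z) : C) (crd A i p) (X p i) =
    h p * (defect hat1 hat2 j k X i p -
      (trans F j k p)^-1 * 'd (fun z => trans F j k (crd_inv A i z) : C) (crd A i p) (X p i))].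
Proof.
have [J [V [r [e [[Vo Vc] VU ce eq]]]]] :=
  hH log_domain_cover defect_cochainP defect_cochain_closed.
pose f w p i : C := e 0 0 (fun=> w) p i (fun=> 0).
have fE w p i v : e 0 0 (fun=> w) p i v = f w p i.
  by congr (e 0 0 _ p i _); apply/funext; case.
have inV w p : V w p -> inter V (fun _ : 'I_1 => w) p by move=> wp l.
have [wc wcP] := choice Vc; have [ic icP] := choice (cm_cover hM).
(* The functions [e] are given chart by chart, and their values agree. *)
have f_chart w p i i' : V w p -> dom A i p -> dom A i' p -> f w p i = f w p i'.
  move=> wp ip i'p; have [hf _] := ce 0 0 (fun=> w).
  by rewrite /f (hf_compat hf _ (inV _ _ wp) ip i'p) fE.
have f_glue w w' p i : V w p -> V w' p -> dom A i p ->
    f w' p i - f w p i = log_trans (r w') p - log_trans (r w) p.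
  move=> wp w'p ip; pose s (l : 'I_2) := if l == ord0 then w else w'.
  have sp : inter V s p by move=> l; rewrite /s; case: ifP.
  have := eq 1 0 s p i (fun=> 0) sp ip.
  rewrite /total_d /= addr0 cech_d_0cochain /s /= !fE => ->.
  by [].
have f_diff w p i v : V w p -> dom A i p ->
    'd (fun z => f w (crd_inv A i z) i : C) (crd A i p) v = index_form (r w) p i v.
  move=> wp ip.
  have Ef : (fun z => f w (crd_inv A i z) i : C) =
      (fun z => e 0 0 (fun=> w) (crd_inv A i z) i ((fun=> v) \o lift ord0)).
    by apply/funext => z; rewrite fE.
  have E := eq 0 1 (fun=> w) p i (fun=> v) (inV _ _ wp) ip.
  rewrite /total_d /= add0r expr0 mul1r exterior_d_function in E.
  by rewrite Ef; apply: esym; exact: E.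
have f_ex w p i : V w p -> dom A i p ->
    differentiable (fun z => f w (crd_inv A i z) i : C) (crd A i p).
  move=> wp ip; have [hf _] := ce 0 0 (fun=> w).
  exact: (hf_holomorphic hf (fun=> 0) (inV _ _ wp) ip).
pose h p : C := cexp (f (wc p) p (ic p) - log_trans (r (wc p)) p).
have hE w p i : V w p -> dom A i p -> h p = cexp (f w p i - log_trans (r w) p).
  move=> wp ip; rewrite /h (f_chart _ _ _ _ (wcP p) (icP p) ip); congr cexp.
  apply/eqP; rewrite -subr_eq0 subr_subACA subr_eq0; apply/eqP.
  exact: f_glue.
have h_diff p i : dom A i p -> is_diff (crd A i p) (fun z => h (crd_inv A i z) : C)
    (fun v => h p * (index_form (r (wc p)) p i v -
       'd (fun z => log_trans (r (wc p)) (crd_inv A i z) : C) (crd A i p) v)).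
  move=> ip; set w := wc p; have wp : V w p := wcP p.
  have D1 := is_diffB (is_diffP (f_ex w p i wp ip))
    (is_diffP (is_diff_ex (log_trans_is_diff ip (VU _ _ wp)))).
  have Ep : f w (crd_inv A i (crd A i p)) i - log_trans (r w) (crd_inv A i (crd A i p)) =
    f w p i - log_trans (r w) p by rewrite (cm_inv hM ip).
  have D2 := is_diff_compE
    (f := fun z => f w (crd_inv A i z) i - log_trans (r w) (crd_inv A i z)) Ep D1 (is_diff_cexp _).
  have N1 := near_dom hM ip.
  have N2 : \forall z \near crd A i p, V w (crd_inv A i z).
    by apply: (near_crd_inv hM ip); apply: open_nbhs_nbhs.
  have E : \forall z \near crd A i p,
    cexp (f w (crd_inv A i z) i - log_trans (r w) (crd_inv A i z)) = h (crd_inv A i z).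
    near=> z; apply: esym; apply: hE; near: z; [exact: N2|exact: N1].
  apply: (eq_is_diff (near_eq_is_diff E D2)) => v.
  rewrite (hE w p i wp ip); congr (_ * (_ - _)).
  exact: f_diff.
exists h; split.
- by move=> i p ip; exact: is_diff_ex (h_diff p i ip).
- by move=> p; exact: cexp_neq0.
move=> i j k p X gX ip jp kp.
apply: (etrans (is_diffE (X p i) (h_diff p i ip))); congr (_ * _).
have pU := VU _ _ (wcP p); have [j'p k'p _] := pU.
rewrite /index_form (dformE hM hg hiso H1 H2 ip j'p k'p gX).
apply: (etrans (congr1 (fun x => _ - x) (is_diffE (X p i) (log_trans_is_diff ip pU)))).
exact: (defect_invariant hM isoF (hat_lifts H1 gX) (hat_lifts H2 gX) ip jp kp j'p k'p).
Unshelve. all: by end_near. Qed.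

End Cech.

(** * Equivalent bundles carry equivalent lifts *)

Section Uniqueness.
Variables (R : realType) (M : topologicalType) (n : nat) (A : atlas R M n).
Hypothesis hM : complex_manifold A.
Local Notation C := (Cplx R).
Variable g : set (field_family A).
Hypothesis hg : lie_algebra_of_vf g.
Hypothesis htr : transitive_vf g.
Hypothesis hH : deRham_trivial A 1.
Hypothesis hiso : forall p : M, ~ exists h : set (field_family A),
  ideal (isotropy g p) h /\ codim1 (isotropy g p) h.

Lemma pushforward_unique (S T : topologicalType) m l (B : atlas R S m) (D : atlas R T l)
    (f : S -> T) (X : field_family B) (Y : field_family D) :
  complex_manifold B -> (forall q, exists e, f e = q) ->
  vector_field D Y -> related f X Y -> Defs.pushforward D f X = Y.
Proof.
move=> hB fsurj vY rY.
have pX : projectable D f X by exists Y.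
have [[tZ _] rZ] := pushforwardP pX; have [tY _] := vY.
apply/funext => q; apply/funext => k; have [e <-] := fsurj q.
have [kp|nkp] := pselect (dom D k (f e)); last by rewrite (tZ _).1 // (tY _).1.
have [i ie] := cm_cover hB e.
by rewrite (rZ _ _ _ ie kp) (rY _ _ _ ie kp).
Qed.

(** With [h] as in [rescaling_factor], the matrix [h c] of the rescaled
    equivalence has logarithmic derivative [beta2 - beta1] along each field,
    which says that the rescaled equivalence carries the first lift of the
    field to the second. *)
Lemma equivariant_of_bundle_equiv (E1 E2 : equivariant_bundle g) :
  bundle_equiv (eb_bundle E1) (eb_bundle E2) -> equivariant_equiv E1 E2.
Proof.
move=> [F isoF].
have [hat1 H1] := lift_map_ex hg (eb_axiom E1).
have [hat2 H2] := lift_map_ex hg (eb_axiom E2).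
have [h [dh h0 hX]] := rescaling_factor hM hg htr hH hiso H1 H2 isoF.
pose F' := rescale h \o F.
have isoF' : bundle_iso F' := bundle_iso_comp isoF (rescale_bundle_iso hM (eb_bundle E2) dh h0).
have [hF' [G [_ _ KG]]] := isoF'.
have transF' j k q : triv j q -> triv k q -> trans F' j k q = h q * trans F j k q.
  move=> jq kq; rewrite /trans /F' /comp.
  have pe : bproj (F (tinv j q 1)) = q.
    by rewrite (bproj_F (proj1 isoF)) (lb_proj (lb_axioms _) _ jq).
  by rewrite fib_rescale pe.
have rel X : g X -> related F' (hat1 X) (hat2 X).
  move=> gX e [i j] [i' k] De De'; have [/= ip jp] := De.
  have pF : bproj (F' e) = bproj e by rewrite (bproj_F hF').
  have [i'p kp] : dom A i' (bproj e) /\ triv k (bproj e).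
    by move: De'; rewrite /= pF.
  rewrite (lift_form hM (hat_lifts H2 gX) De') (lift_form hM (hat_lifts H1 gX) De) pF.
  apply: esym; apply: (etrans (diff_bundle_map hM hF' _ _ De i'p kp)).
  have tX : X (bproj e) i' = 'd (crd A i' \o crd_inv A i) (crd A i (bproj e)) (X (bproj e) i).
    by have [gv _ _] := hg; exact: ((gv _ gX).1 _).2.
  rewrite (transE hF' jp kp) (transF' _ _ _ jp kp).
  rewrite (beta_chart hM (hat_lifts H2 gX) ip i'p kp) -tX; congr (row_mx _ (const_mx _)).
  have Eh := hX i j k (bproj e) X gX ip jp kp.
  have D1 := is_diffP (dh i _ ip).
  have D2 := is_diffP (trans_differentiable (proj1 isoF) ip jp kp).
  have E : \forall z \near crd A i (bproj e),
      h (crd_inv A i z) * trans F j k (crd_inv A i z) = trans F' j k (crd_inv A i z).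
    have N1 := near_crd_inv hM ip (nbhs_triv jp).
    have N2 := near_crd_inv hM ip (nbhs_triv kp).
    by near=> z; apply: esym; apply: transF'; near: z.
  have E' := is_diffE (X (bproj e) i) (near_eq_is_diff E (is_diff_mul D1 D2)).
  rewrite /= (cm_inv hM ip) in E'.
  have E3 := etrans E' (congr1 (fun x => _ + _ * x) Eh).
  apply: (etrans (congr1 (fun x => _ * x + _) E3)).
  exact: (rescaled_derivative _ _ _ _ _ (trans_neq0 isoF jp kp)).
have push X : g X -> Defs.pushforward (total_atlas A (eb_bundle E2)) F' (hat1 X) = hat2 X.
  move=> gX; apply: pushforward_unique (rel _ gX).
  - exact: (lb_total (lb_axioms (eb_bundle E1))).
  - by move=> q; exists (G q); exact: KG.
  - by have [] := hat_lifts H2 gX.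
exists F'; split=> //; apply/seteqP; split=> [_ [Xh ghX <-]|Xh ghX].
  have [X gX ->] := hat_onto H1 ghX.
  by rewrite push //; exact: (hat_in H2).
have [X gX ->] := hat_onto H2 ghX.
by exists (hat1 X); [exact: (hat_in H1) | exact: push].
Unshelve. all: by end_near. Qed.

End Uniqueness.

Theorem corollary5 (R : realType) (M : topologicalType) (n : nat)
  (A : atlas R M n) (hM : complex_manifold A)
  (g : set (field_family A)) (hg : lie_algebra_of_vf g)
  (htr : transitive_vf g)
  (hH : deRham_trivial A 1)
  (hiso : forall p : M,
     ~ exists h : set (field_family A),
         ideal (isotropy g p) h /\ codim1 (isotropy g p) h) :
  injective (forget g).
Proof.
(* Equivariant equivalence is thus pulled back from [bundle_equiv], and the
   classes are equal as predicates once the underlying bundles are equivalent. *)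
have equivP (E E' : equivariant_bundle g) :
    equivariant_equiv E E' = bundle_equiv (eb_bundle E) (eb_bundle E').
  apply/propext; split; last exact: equivariant_of_bundle_equiv.
  by move=> [F [isoF _]]; exists F.
move=> [c1 ex1] [c2 ex2] /(congr1 sval) /= E.
have [E1 c1E] := ex1; have [E2 c2E] := ex2.
have E12 : bundle_equiv (eb_bundle E1) (eb_bundle E2).
  have : exists2 E', c1 E' & bundle_equiv (eb_bundle E') (eb_bundle E2).
    rewrite (congr1 (@^~ (eb_bundle E2)) E); exists E2; last exact: bundle_equiv_refl.
    by rewrite c2E; exact: equivariant_equiv_refl.
  by move=> [E']; rewrite c1E equivP; exact: bundle_equiv_trans.
have c12 : c1 = c2.
  rewrite c1E c2E; apply/funext => E'; rewrite !equivP; apply/propext; split.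
    by apply: bundle_equiv_trans; exact: bundle_equiv_sym.
  exact: bundle_equiv_trans.
by move: ex1 ex2 {E c1E c2E}; rewrite c12 => ex1 ex2; congr exist; exact: Prop_irrelevance.
Qed.
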